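(* Let $0<i<d-1$, let $q\ge 2$ be an integer, let $\beta\in(0,\infty)$, let $\gamma\in Z_{i-1}(\mathbb Z^d;\mathbb Z_q)$ be an $(i-1)$-cycle in $\mathbb Z^d$, and let $(\#_1,\#_2)\in\{(\mathbf f,\mathrm{fin}),(\mathbf w,\mathrm{inf})\}$. Let $\nu=\nu^{\#_1}_{\mathbb Z^d,\beta,q,i-1}$ be the infinite volume $(i-1)$-dimensional $q$-state Potts lattice gauge theory with boundary conditions $\#_1$ and let $\tilde\mu=\tilde\mu^{\#_1}_{\mathbb Z^d,1-e^{-\beta},\mathbb Z_q,i}$ be the corresponding infinite volume plaquette random-cluster model. Then $$\mathbb E_\nu(W_\gamma)=\tilde\mu\left(V^{\#_2}_\gamma(q)\right).$$
   Context: **Cells.** $\mathbb Z^d$ is the cubical complex on $\mathbb R^d$ whose $j$-cells ($j$-plaquettes) are unit $j$-cubes with integer corners. Cellular chains, cycles and boundaries are $C_j,Z_j,B_j$; cochains and cocycles are $C^j,Z^j$ with $\delta f(\sigma)=f(\partial\sigma)$; $H_j,H^j$ are reduced. $\mathbb Z_q=\mathbb Z/q\mathbb Z$, $\Lambda_N=[-N,N]^d$. An $i$-dimensional percolation subcomplex $P$ of a complex $X$ satisfies $X^{(i-1)}\subset P\subset X^{(i)}$ ($j$-skeletons); $|P|$ is its number of $i$-cells. When $\Lambda_N$ is used as an $i$-dimensional complex, the $i$-cells contained in $\partial\Lambda_N$ are removed. **Plaquette random-cluster model (PRCM).** $\tilde\mu^{\mathbf f}_{\Lambda_N,p,\mathbb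 Z_q,i}(P)\propto p^{|P|}(1-p)^{n_N-|P|}\,|H^{i-1}(P;\mathbb Z_q)|$, over $i$-dimensional percolation subcomplexes $P$ of $\Lambda_N$ (no $i$-cells in $\partial \Lambda_N$), with $n_N$ the number of $i$-cells of $\Lambda_N$ not in $\partial\Lambda_N$. $\tilde\mu^{\mathbf w}_{\Lambda_N,p,\mathbb Z_q,i}$ is defined in the same way with $|H^{i-1}(P\cup\partial\Lambda_N;\mathbb Z_q)|$ in place of $|H^{i-1}(P;\mathbb Z_q)|$, where $P\cup\partial\Lambda_N$ means that all $i$-cells in $\partial\Lambda_N$ are added. **Potts lattice gauge theory (PLGT).** $\nu^{\mathbf f}_{\Lambda_N,\beta,q,i-1}$ is the probability measure on $C^{i-1}(\Lambda_N;\mathbb Z_q)$ with weight proportional to $\exp\left(\beta\sum_\sigma K(\delta f(\sigma),0)\right)$, the sum over $i$-cells $\sigma$ of $\Lambda_N$ not in $\partial\Lambda_N$, $K$ the Kronecker delta. $\nu^{\mathbf w}_{\Lambda_N,\beta,q,i-1}$ is this measure conditioned on $f|_{\partial\Lambda_N}$ being a cocycle of $\partial\Lambda_N$. The infinite volume measures $\nu^{\#_1}_{\mathbb Z^d,\beta,q,i-1}$ and $\tilde\mu^{\#_1}_{\mathbb Z^d,p,\mathbb Z_q,i}$ are the weak limits of these finite volume measures as $N\to\infty$. **Observables and events.** $W_\gamma(f)=e^{2\pi\sqrt{-1}\,f(\gamma)/q}$. $V^{\mathrm{fin}}_\gamma(q)$ is the event $\gamma\in B_{i-1}(P;\mathbb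 Z_q)$. $V^{\mathrm{inf}}_\gamma(q)$ is the union of $V^{\mathrm{fin}}_\gamma(q)$ and the event that, for arbitrarily large $n$, $\gamma$ is homologous in $P$ (coefficients $\mathbb Z_q$) to a cycle supported in the boundary of the cube $[-n,n]^d$. *)

(* Defs.v *)
From HB Require Import structures.
From mathcomp Require Import all_boot all_order all_algebra finmap.
From mathcomp Require Import all_classical all_reals all_analysis.
From mathcomp Require Import complex.

Set Implicit Arguments.
Unset Strict Implicit.
Unset Printing Implicit Defensive.

Import Order.TTheory GRing.Theory Num.Theory numFieldNormedType.Exports.

Local Open Scope classical_set_scope.
Local Open Scope ring_scope.

HB.instance Definition _ (n : nat) := isPointed.Build 'I_n.+1 ord0.

(* The pair (x, S) encodes the cube that is the product over k of the interval
   [x_k, x_k + 1] if k is in S and of the point {x_k} otherwise. *)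
Definition cell (d j : nat) : Type :=
  {c : {ffun 'I_d -> int} * {set 'I_d} | #|c.2| == j}.

Section Cells.
Context {d j : nat}.
Implicit Type c : cell d j.

Definition corner c : {ffun 'I_d -> int} := (val c).1.
Definition dirs c : {set 'I_d} := (val c).2.

Definition lower_face c (k : 'I_d) := (corner c, dirs c :\ k)%SET.
Definition upper_face c (k : 'I_d) :=
  ([ffun l => corner c l + (l == k)%:Z], dirs c :\ k)%SET.

(* The coefficient of t in the cellular boundary of c, for the product
   orientation of cubes. *)
Definition incidence {j' : nat} c (t : cell d j') : int :=
  \sum_(k in dirs c) (-1) ^+ #|[set l in dirs c | (l < k)%N]%SET| *
    ((val t == upper_face c k)%:Z - (val t == lower_face c k)%:Z).

Definition in_cube (N : nat) c : bool :=
  [forall k, (- N%:Z <= corner c k) &&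
             (corner c k + (k \in dirs c)%:Z <= N%:Z)].

Definition on_cube_boundary (N : nat) c : bool :=
  in_cube N c &&
  [exists k, (k \notin dirs c) && (`|corner c k| == N%:Z)].

End Cells.

(* fset_set returns the empty set on infinite sets; see in_cells_in_cube. *)
Definition cells_in_cube (d N j : nat) : {fset cell d j} :=
  fset_set [set c : cell d j | in_cube N c].

Lemma finite_in_cube (d N j : nat) :
  finite_set [set c : cell d j | in_cube N c].
Proof.
have [[c0 _]|A0] := pselect ([set c : cell d j | in_cube N c] !=set0); last first.
  suff -> : [set c : cell d j | in_cube N c] = set0 by exact: finite_set0.
  by apply/seteqP; split=> // c Hc; case: A0; exists c.
pose g (u : {ffun 'I_d -> 'I_(N + N).+1} * {set 'I_d}) : cell d j :=
  insubd c0 ([ffun k => (u.1 k : nat)%:Z - N%:Z], u.2).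
apply: (@sub_finite_set _ _ (range g)); last exact/finite_image/finite_finset.
move=> c /forallP Hc.
exists ([ffun k => inord (absz (corner c k + N%:Z)%R)], dirs c) => //.
apply: val_inj; rewrite /g val_insubd /=.
have -> : ([ffun k => ([ffun k0 => inord (absz (corner c k0 + N%:Z)%R)] k
           : 'I_(N + N).+1)%:Z - N%:Z], dirs c) = val c.
  rewrite [RHS]surjective_pairing; congr pair; apply/ffunP => k.
  rewrite !ffunE; move/andP: (Hc k) => [h1 h2].
  have h3 : 0 <= corner c k + N%:Z by rewrite -lerBlDr sub0r.
  have h4 : corner c k <= N%:Z by apply: le_trans h2; rewrite lerDl; case: (_ \in _).
  rewrite inordK; first by rewrite gez0_abs // addrK.
  rewrite ltnS -lez_nat gez0_abs // PoszD.
  by rewrite lerD2r.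
by rewrite (valP c).
Qed.

Lemma in_cells_in_cube (d N j : nat) (c : cell d j) :
  (c \in cells_in_cube d N j) = in_cube N c.
Proof.
rewrite in_fset_set; last exact: finite_in_cube.
by apply/idP/idP; rewrite inE.
Qed.

Definition chain (d q j : nat) := {fsfun cell d j -> 'Z_q with 0}.

Section Chains.
Context {d q j : nat}.
Implicit Types c g : chain d q j.

Definition boundary {j' : nat} c (t : cell d j') : 'Z_q :=
  \sum_(s <- finsupp c) c s *~ incidence s t.

(* The pairing f(g) of a cochain f of Z^d with a chain g. *)
Definition evaluate (f : cell d j -> 'Z_q) g : 'Z_q :=
  \sum_(s <- finsupp g) g s * f s.

End Chains.

(* The chain complex is augmented, since homology is reduced: a 0-chain is a
   cycle when its coefficients sum to 0. *)
Definition is_cycle {d q j : nat} : chain d q j -> Prop :=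
  match j with
  | 0 => fun c => \sum_(s <- finsupp c) c s = 0
  | j'.+1 => fun c => forall t : cell d j', boundary c t = 0
  end.

(* exp(2 pi i k / q) *)
Definition exp_2pii_div (R : realType) (q : nat) (k : 'Z_q) : R[i] :=
  let t := 2 * pi * (k : nat)%:R / q%:R in Complex (cos t) (sin t).

Definition wilson_loop (R : realType) {d q j : nat} (g : chain d q j)
    (f : cell d j -> 'Z_q) : R[i] :=
  exp_2pii_div R (evaluate f g).

(* An i-dimensional percolation subcomplex of Z^d contains every cell of
   dimension less than i, so it is given by the set P of its i-cells.  In the
   events below g is a chain of dimension i.-1. *)
Section Events.
Context {d q i : nat}.
Implicit Types (P : cell d i -> bool) (g : chain d q i.-1).

Definition homologous P g g' : Prop :=
  exists2 b : chain d q i, (forall s, s \in finsupp b -> P s) &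
    forall t : cell d i.-1, boundary b t = g t - g' t.

Definition V_fin g : set (cell d i -> bool) :=
  [set P | exists2 b : chain d q i, (forall s, s \in finsupp b -> P s) &
    forall t : cell d i.-1, boundary b t = g t].

Definition V_inf g : set (cell d i -> bool) :=
  V_fin g `|`
  [set P | forall m : nat, exists n : nat, (m <= n)%N /\
    exists g' : chain d q i.-1,
      [/\ is_cycle g', (forall t, t \in finsupp g' -> on_cube_boundary n t)
        & homologous P g g']].

End Events.

Variant boundary_condition := Free | Wired.

(* The pairs (f, fin) and (w, inf). *)
Definition V_event {d q i : nat} (bc : boundary_condition)
    (g : chain d q i.-1) : set (cell d i -> bool) :=
  match bc with Free => V_fin g | Wired => V_inf g end.

Section FiniteVolume.
Context (d q N : nat).

Definition inner_cells (j : nat) : {fset cell d j} :=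
  [fset s in cells_in_cube d N j | ~~ on_cube_boundary N s]%fset.

Definition boundary_cells (j : nat) : {fset cell d j} :=
  [fset s in cells_in_cube d N j | on_cube_boundary N s]%fset.

Definition cochain (j : nat) := {ffun cells_in_cube d N j -> 'Z_q}.

Definition coboundary {j j' : nat} (f : cochain j) (s : cell d j') : 'Z_q :=
  \sum_(t : cells_in_cube d N j) f t *~ incidence s (val t).

Definition cocycles {j j' : nat} (P : {fset cell d j'}) : {set cochain j} :=
  [set f : cochain j | [forall s : P, coboundary f (val s) == 0]]%SET.

(* The cochain complex is augmented: in degree 0 the coboundaries are the
   constant functions. *)
Definition coboundaries (j : nat) : {set cochain j} :=
  match j return {set cochain j} with
  | 0 => [set [ffun=> a] | a in [set: 'Z_q]]%SET
  | j'.+1 => [set [ffun t : cells_in_cube d N j'.+1 => coboundary f (val t)]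
               | f in [set: cochain j']]%SET
  end.

(* H^(i-1)(P; Z_q), as the set of classes of cocycles modulo coboundaries, for
   the percolation subcomplex of [-N, N]^d whose set of i-cells is P; its
   cells of dimension i-1 and i-2 are all those of the cube. *)
Definition cohomology {i : nat} (P : {fset cell d i}) :
    {set {set cochain i.-1}} :=
  equivalence_partition (fun f g : cochain i.-1 => f - g \in coboundaries i.-1)
    (cocycles P).

End FiniteVolume.

Definition normalized (R : realType) (T : finType) (w : T -> R) (x : T) : R :=
  w x / \sum_y w y.

Definition conditioned (R : realType) (T : finType) (m : T -> R) (A : {set T})
    (x : T) : R :=
  if x \in A then m x / \sum_(y in A) m y else 0.

(* Plaquette random-cluster model, as a probability mass function on the
   subsets of the set of i-cells of the cube not in its boundary. *)
Section PRCM.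
Context (R : realType) (d q i N : nat) (p : R) (bc : boundary_condition).

Definition PRCM_config := fpowerset (inner_cells d N i).

Definition PRCM_complex (P : {fset cell d i}) : {fset cell d i} :=
  match bc with Free => P | Wired => (P `|` boundary_cells d N i)%fset end.

Definition PRCM_weight (P : PRCM_config) : R :=
  p ^+ #|` val P| * (1 - p) ^+ (#|` inner_cells d N i| - #|` val P|) *
  #|cohomology q N (PRCM_complex (val P))|%:R.

Definition PRCM : PRCM_config -> R := normalized PRCM_weight.

(* How P is extended outside the cube does not affect the weak limit; here the
   i-cells of Z^d outside P are absent. *)
Definition PRCM_extend (P : PRCM_config) : cell d i -> bool :=
  fun s => s \in val P.

End PRCM.

(* Potts lattice gauge theory of dimension i.-1, as a probability mass function
   on the (i-1)-cochains of the cube. *)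
Section PLGT.
Context (R : realType) (d q i N : nat) (beta : R) (bc : boundary_condition).

Definition PLGT_weight (f : cochain d q N i.-1) : R :=
  expR (beta * \sum_(s <- inner_cells d N i) (coboundary f s == 0)%:R).

Definition PLGT : cochain d q N i.-1 -> R :=
  match bc with
  | Free => normalized PLGT_weight
  | Wired => conditioned (normalized PLGT_weight)
               (cocycles q N (boundary_cells d N i))
  end.

(* As above, the extension by 0 does not affect the weak limit. *)
Definition PLGT_extend (f : cochain d q N i.-1) : cell d i.-1 -> 'Z_q :=
  fun s => if insub s is Some t then f t else 0.

End PLGT.

(* Configurations with the product of the discrete topologies, and the
   corresponding Borel space. *)
Definition config (I : Type) (S : pointedType) : topologicalType :=
  {ptws I -> discrete_topology S}.

Notation borel_config I S := (g_sigma_algebraType (@open (config I S))).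

(* Weak convergence to mu of the laws of ext_N(x), for x distributed according
   to the probability mass function m_N. *)
Definition weak_limit (R : realType) (I : Type) (S : pointedType)
    (T : nat -> finType) (m : forall N, T N -> R)
    (ext : forall N, T N -> (I -> S)) (mu : probability (borel_config I S) R) :=
  forall h : config I S -> R,
    continuous h -> [bounded h x | x in setT] ->
    (fun N => \sum_(x : T N) m N x * h (ext N x)) @ \oo -->
      \int[mu]_x h x.

Definition is_infinite_PRCM (R : realType) (d q i : nat) (p : R)
    (bc : boundary_condition) (mu : probability (borel_config (cell d i) bool) R) :=
  weak_limit (fun N => @PRCM R d q i N p bc) (fun N => @PRCM_extend d i N) mu.

Definition is_infinite_PLGT (R : realType) (d q i : nat) (beta : R)
    (bc : boundary_condition)
    (nu : probability (borel_config (cell d i.-1) 'Z_q) R) :=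
  weak_limit (fun N => @PLGT R d q i N beta bc) (fun N => @PLGT_extend d q i N) nu.

Definition complex_expectation (R : realType) (disp : measure_display)
    (T : measurableType disp) (nu : probability T R) (X : T -> R[i]) : R[i] :=
  Complex (\int[nu]_x complex.Re (X x)) (\int[nu]_x complex.Im (X x)).

(* Main.v *)
Require Import Defs.
From mathcomp Require Import all_boot all_order all_algebra finmap.
From mathcomp Require Import all_classical all_reals all_analysis.
From mathcomp Require Import complex zify ring lra.

(** In a cube, expand the weight of the gauge theory over sets P of i-cells, by
    exp(beta K) = 1 + (exp(beta) - 1) K, where K is 1 if the coboundary vanishes on a
    cell and 0 otherwise ([PLGT_weight_expand]).  Summing out the cochain leaves
    the weight (exp(beta) - 1)^|P| times the number of cocycles of P, and this is the
    random-cluster weight up to a constant, because every cohomology class contains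
    the same number of cocycles ([card_cohomology]).  Given P, the cochain is a
    uniformly distributed cocycle of P, and the Wilson loop is a character of the
    group of cocycles.  Its mean is 1 if it is trivial and 0
    otherwise.  It is trivial when all cocycles vanish on gamma, and by duality
    over Z_q this happens exactly when gamma bounds in P ([annihilatorK],
    [bounds_dual]).  So in a cube the expectation of the Wilson loop is the probability
    that gamma bounds in P, or in the union of P and the boundary of the cube for
    wired boundary conditions ([wilson_loop_finite]).

    In infinite volume the event is no longer local, and weak convergence alone gives
    only an inequality.  The other one comes from stochastic monotonicity.  The
    random-cluster weight is log-supermodular, since the cocycles of a union are
    the common cocycles, and the four functions theorem ([four_functions]) then
    shows that the finite volume measures increase with the cube for free boundary
    conditions and decrease for wired ones ([cluster_mean_free], [cluster_mean_wired]).
    The event that gamma bounds in the cube of size n is increasing in n in the free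
    case, with union V_fin ([V_fin_local]), and decreasing in the wired case, with
    intersection V_inf ([V_inf_local]).  Hence its probability in the limit measure lies
    between its probability in the cube of size n, which is a Wilson loop
    expectation, and the limit of these expectations ([event_between]).  As n grows
    both bounds tend to the expectation in infinite volume.

    Two topological facts enter in the wired case.  The boundary of a cube is a
    (d-1)-sphere, so an (i-1)-cycle on it bounds on it ([fill_sphere]); and a cocycle
    in a cube that is a cocycle on its boundary extends to a cocycle in the annulus
    up to a larger cube, by pulling back along the map that clamps the
    coordinates ([cbd_retract], [cluster_weight_volume]). *)

Set Implicit Arguments.
Unset Strict Implicit.
Unset Printing Implicit Defensive.

Import Order.TTheory GRing.Theory Num.Theory numFieldNormedType.Exports.

Local Open Scope classical_set_scope.
Local Open Scope ring_scope.

(** * Positive association *)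

(** The four functions inequality on a lattice with one element.  With w = c1 d0,
    u = a0 b1 and v = a1 b0, the terms that mix the indices are controlled by
    (w - u) (w - v) >= 0 together with u v = (a0 b0) (a1 b1), after multiplication
    by w. *)
Lemma four_numbers (R : realDomainType) (a0 a1 b0 b1 c0 c1 d0 d1 : R) :
  0 <= a0 -> 0 <= a1 -> 0 <= b0 -> 0 <= b1 ->
  0 <= c0 -> 0 <= c1 -> 0 <= d0 -> 0 <= d1 ->
  a0 * b0 <= c0 * d0 -> a0 * b1 <= c1 * d0 ->
  a1 * b0 <= c1 * d0 -> a1 * b1 <= c1 * d1 ->
  (a0 + a1) * (b0 + b1) <= (c0 + c1) * (d0 + d1).
Proof.
move=> pa0 pa1 pb0 pb1 pc0 pc1 pd0 pd1 h00 h01 h10 h11.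
set w := c1 * d0 in h01 h10 *.
have w0 : 0 <= w by exact: mulr_ge0.
have := w0; rewrite le0r => /predU1P[w_eq0|w_gt0].
  have e01 : a0 * b1 = 0 by apply/le_anti; rewrite -{1}w_eq0 h01 mulr_ge0.
  have e10 : a1 * b0 = 0 by apply/le_anti; rewrite -{1}w_eq0 h10 mulr_ge0.
  have cd : 0 <= c0 * d1 by exact: mulr_ge0.
  rewrite !mulrDl !mulrDr e01 e10 -/w w_eq0; lra.
rewrite -(ler_pM2l w_gt0).
set u := a0 * b1 in h01 *; set v := a1 * b0 in h10 *.
set s := a0 * b0 in h00 *; set t := a1 * b1 in h11 *.
have uv : u * v = s * t by rewrite /u /v /s /t; ring.
have -> : w * ((a0 + a1) * (b0 + b1)) = w * (s + t + u + v).
  by rewrite /u /v /s /t; ring.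
have -> : w * ((c0 + c1) * (d0 + d1)) =
    w * (c0 * d0 + c1 * d1 + w) + (c0 * d0) * (c1 * d1).
  by rewrite /w; ring.
have s0 : 0 <= s by exact: mulr_ge0.
have t0 : 0 <= t by exact: mulr_ge0.
have hst : s * t <= (c0 * d0) * (c1 * d1) by exact: ler_pM.
have huv : 0 <= (w - u) * (w - v) by rewrite mulr_ge0 // subr_ge0.
have hw : w * (s + t) <= w * (c0 * d0 + c1 * d1) by rewrite ler_pM2l // lerD.
have -> : w * (s + t + u + v) = w * (s + t) + (w * w + u * v - (w - u) * (w - v)).
  by ring.
by rewrite (mulrDr w (_ + _)); lra.
Qed.

Section FourFunctions.
Context {K : choiceType}.
Implicit Types (S P Q : {fset K}).
Local Open Scope fset_scope.

Lemma fsum_fpowersetU1 (R : nmodType) (f : {fset K} -> R) (x : K) S :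
  x \notin S ->
  (\sum_(P <- fpowerset (x |` S)) f P)%R =
  (\sum_(P <- fpowerset S) (f P + f (x |` P)))%R.
Proof.
move=> xS; rewrite big_split /=.
rewrite (bigID (fun P : {fset K} => x \in P)) /= addrC; congr (_ + _)%R.
  rewrite -big_filter; apply: perm_big; apply: uniq_perm.
  - exact/filter_uniq/fset_uniq.
  - exact: fset_uniq.
  move=> P; rewrite mem_filter !fpowersetE.
  apply/andP/idP => [[xP /fsubsetP PS]|/fsubsetP PS].
    apply/fsubsetP => y yP; have := PS _ yP; rewrite !inE => /predU1P[yx|//].
    by rewrite -yx yP in xP.
  split; first by apply: contra xS => /PS.
  by apply/fsubsetP => y /PS yS; rewrite !inE yS orbT.
rewrite -big_filter -[RHS](big_map (fun P => x |` P) xpredT f).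
apply: perm_big; apply: uniq_perm.
- exact/filter_uniq/fset_uniq.
- rewrite map_inj_in_uniq ?fset_uniq // => P Q.
  rewrite !fpowersetE => /fsubsetP PS /fsubsetP QS /fsetP PQ.
  apply/fsetP => y; have := PQ y; rewrite !inE.
  have [->|//] := eqVneq y x.
  by move=> _; rewrite (contraNF (PS _) xS) (contraNF (QS _) xS).
move=> P; rewrite mem_filter fpowersetE.
apply/andP/mapP => [[xP /fsubsetP PS]|[Q]]; last first.
  by rewrite fpowersetE => QS ->; rewrite !inE eqxx fsetUS.
exists (P `\ x); last by rewrite fsetD1K.
rewrite fpowersetE; apply/fsubsetP => y; rewrite !inE => /andP[yx /PS].
by rewrite !inE (negPf yx).
Qed.

(** The Ahlswede-Daykin inequality.  Summing the four functions over the two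
    possible states of one element x preserves the hypothesis, by the case of
    a one-element lattice; so the elements can be summed out one by one. *)
Lemma four_functions (R : realDomainType) S (a b c d : {fset K} -> R) :
  (forall P, 0 <= a P)%R -> (forall P, 0 <= b P)%R ->
  (forall P, 0 <= c P)%R -> (forall P, 0 <= d P)%R ->
  (forall P Q, a P * b Q <= c (P `|` Q) * d (P `&` Q))%R ->
  ((\sum_(P <- fpowerset S) a P) * (\sum_(P <- fpowerset S) b P) <=
   (\sum_(P <- fpowerset S) c P) * (\sum_(P <- fpowerset S) d P))%R.
Proof.
elim/finSet_rect: S a b c d => S IH a b c d a0 b0 c0 d0 abcd.
have [->|[x xS]] := fset_0Vmem S.
  by rewrite fpowerset0 !big_seq_fset1; have := abcd fset0 fset0; rewrite fsetUid fsetIid.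
rewrite -(fsetD1K xS) !fsum_fpowersetU1; do ?by rewrite !inE eqxx.
pose sumx (f : {fset K} -> R) P := (f (P `\ x) + f (x |` P))%R.
have sumxE f : (\sum_(P <- fpowerset (S `\ x)) (f P + f (x |` P)))%R =
    (\sum_(P <- fpowerset (S `\ x)) sumx f P)%R.
  rewrite big_seq_cond [RHS]big_seq_cond; apply: eq_bigr => P.
  rewrite andbT fpowersetE => /fsubsetP PS; rewrite /sumx; congr (f _ + _)%R.
  apply/fsetP => y; rewrite !inE; have [->|//] := eqVneq y x.
  by apply/negP => /PS; rewrite !inE eqxx.
rewrite !sumxE; apply: IH.
- exact: fproperD1.
- by move=> P; apply: addr_ge0.
- by move=> P; apply: addr_ge0.
- by move=> P; apply: addr_ge0.
- by move=> P; apply: addr_ge0.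
move=> P Q; rewrite /sumx.
have U00 : (P `|` Q) `\ x = (P `\ x) `|` (Q `\ x) by rewrite fsetDUl.
have U11 : x |` (P `|` Q) = (x |` P) `|` (x |` Q) by rewrite fsetUUr.
have U01 : x |` (P `|` Q) = (P `\ x) `|` (x |` Q).
  by apply/fsetP => y; rewrite !inE; case: eqP => //= _; case: (y \in P).
have U10 : x |` (P `|` Q) = (x |` P) `|` (Q `\ x).
  by apply/fsetP => y; rewrite !inE; case: eqP => //= _; case: (y \in P).
have I00 : (P `&` Q) `\ x = (P `\ x) `&` (Q `\ x).
  by apply/fsetP => y; rewrite !inE; case: eqP.
have I11 : x |` (P `&` Q) = (x |` P) `&` (x |` Q) by rewrite fsetUIr.
have I01 : (P `&` Q) `\ x = (P `\ x) `&` (x |` Q).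
  by apply/fsetP => y; rewrite !inE; case: eqP.
have I10 : (P `&` Q) `\ x = (x |` P) `&` (Q `\ x).
  by apply/fsetP => y; rewrite !inE; case: eqP => //=; rewrite ?andbF.
apply: four_numbers => //.
- by rewrite U00 I00.
- by rewrite U01 I01.
- by rewrite U10 I10.
- by rewrite U11 I11.
Qed.
End FourFunctions.

(** * Characters and duality over Z_q *)

Section Characters.
Context (R : realType) (q : nat) (q_gt1 : (1 < q)%N).
Local Notation e := (@exp_2pii_div R q).

(** The exponential is periodic, so it may be computed on any representative of a
    residue class. *)
Lemma exp_2pii_div_nat (n : nat) :
  e n%:R = Complex (cos (2 * pi * n%:R / q%:R)) (sin (2 * pi * n%:R / q%:R)).
Proof.
rewrite /exp_2pii_div val_Zp_nat //.
have q0 : (q%:R : R) != 0 by rewrite pnatr_eq0; lia.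
have E : 2 * pi * n%:R / q%:R =
    2 * pi * (n %% q)%:R / q%:R + (pi *+ 2) *+ (n %/ q) :> R.
  rewrite {1}(divn_eq n q) natrD natrM -mulr_natl -(mulr_natl _ (n %/ q)); field.
  exact: q0.
by rewrite E (periodicn (@cosD2pi R)) (periodicn (@sinD2pi R)).
Qed.

Lemma exp_2pii_divD (a b : 'Z_q) : e (a + b) = e a * e b.
Proof.
rewrite -(natr_Zp a) -(natr_Zp b) -natrD !exp_2pii_div_nat natrD mulrDr mulrDl.
by rewrite cosD sinD; apply/eqP; rewrite eq_complex /= eqxx /= addrC eqxx.
Qed.

Lemma exp_2pii_div0 : e 0 = 1.
Proof.
by rewrite -[0]/(0%:R) exp_2pii_div_nat mulr0 mul0r cos0 sin0.
Qed.

Lemma exp_2pii_div_eq1 (a : 'Z_q) : (e a == 1) = (a == 0).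
Proof.
apply/eqP/eqP => [|->]; last exact: exp_2pii_div0.
rewrite /exp_2pii_div => -[cos1 _]; apply/eqP; apply: contraT => a_neq0.
have q0 : (0 : R) < q%:R by rewrite ltr0n; lia.
set x : R := pi * (a : nat)%:R / q%:R.
have x_gt0 : 0 < x.
  by rewrite divr_gt0 // mulr_gt0 ?pi_gt0 // ltr0n lt0n.
have x_ltpi : x < pi.
  rewrite /x ltr_pdivrMr // ltr_pM2l ?pi_gt0 // ltr_nat.
  by rewrite -[X in (_ < X)%N](Zp_cast q_gt1); exact: ltn_ord.
have sin0 : 0 < sin x by rewrite sin_gt0_pi // x_gt0.
have : cos (x *+ 2) = 1 by rewrite -cos1 /x -mulr_natl; congr cos; ring.
rewrite cos_mulr2n cos2sin2 => H.
have : sin x ^+ 2 = 0 by lra.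
by move/eqP; rewrite sqrf_eq0 => /eqP sx; rewrite sx ltxx in sin0.
Qed.

Context {I : finType}.
Local Notation V := {ffun I -> 'Z_q}.
Implicit Types (M : {set V}) (x y : V).

(** A character that is not trivial on a finite group sums to zero over it:
    a translation multiplies the sum by a factor different from one. *)
Lemma sum_character M (l : V -> 'Z_q) :
  zmod_closed M -> {morph l : x y / x + y} ->
  \sum_(x in M) e (l x) = if [forall x in M, l x == 0] then #|M|%:R else 0.
Proof.
move=> MZ lD; case: ifPn => [/forall_inP l0|].
  rewrite -sum1_card natr_sum; apply: eq_bigr => x /l0 /eqP ->.
  exact: exp_2pii_div0.
rewrite negb_forall_in => /exists_inP[y yM ly].
have sE : \sum_(x in M) e (l x) = e (l y) * \sum_(x in M) e (l x).
  rewrite {1}(reindex_inj (addIr y)) /= mulr_sumr.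
  apply: eq_big => [x|x _]; last by rewrite lD exp_2pii_divD mulrC.
  have MN : y \in M -> - y \in M by move=> h; rewrite -sub0r; apply: (MZ.2) => //; exact: (MZ.1).
  apply/idP/idP => [xyM|xM]; first by rewrite -[x](addrK y); apply: (MZ.2).
  by rewrite -[y]opprK; apply: (MZ.2) => //; exact: MN.
have : (1 - e (l y)) * \sum_(x in M) e (l x) = 0.
  by rewrite mulrBl mul1r -sE subrr.
move=> /eqP; rewrite mulf_eq0 subr_eq0 eq_sym exp_2pii_div_eq1 (negPf ly).
by move/eqP.
Qed.

Definition dot x y : 'Z_q := \sum_i x i * y i.

Lemma dotC x y : dot x y = dot y x.
Proof. by apply: eq_bigr => i _; rewrite mulrC. Qed.

Lemma dotDl x y z : dot (x + y) z = dot x z + dot y z.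
Proof.
by rewrite /dot -big_split; apply: eq_bigr => i _; rewrite ffunE mulrDl.
Qed.

Definition annihilator M : {set V} := [set f | [forall x in M, dot x f == 0]]%SET.

Lemma annihilator_zmod M : zmod_closed (annihilator M).
Proof.
have dN x y : dot x (- y) = - dot x y.
  by rewrite /dot -sumrN; apply: eq_bigr => i _; rewrite ffunE mulrN.
split=> [|f g]; rewrite !inE.
  apply/forall_inP => x _; rewrite /dot big1 // => i _.
  by rewrite ffunE mulr0.
move=> /forall_inP fM /forall_inP gM; apply/forall_inP => x xM.
by rewrite dotC dotDl dotC [X in _ + X]dotC dN (eqP (fM x xM)) (eqP (gM x xM)) subrr.
Qed.

Lemma annihilator_setT (x : V) : [forall f, dot x f == 0] = (x == 0).
Proof.
apply/forallP/eqP => [x0|-> f]; last first.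
  by rewrite /dot big1 // => i _; rewrite ffunE mul0r.
apply/ffunP => i; rewrite ffunE.
have /eqP := x0 [ffun k => (k == i)%:R].
rewrite /dot (bigD1 i) //= big1 => [|k /negPf ki]; rewrite ffunE ?ki ?mulr0 //.
by rewrite eqxx mulr1 addr0.
Qed.

(** Both sides count the double sum of exp(2 pi i f(x) / q) over x in M and
    all f: summing over x first leaves only the f that annihilate M, summing
    over f first leaves only x = 0. *)
Lemma card_annihilator M : zmod_closed M ->
  (#|M| * #|annihilator M| = #|{: V}|)%N.
Proof.
move=> MZ.
have setTZ : zmod_closed [set: V]%SET by split=> [|x y _ _]; rewrite finset.in_setT.
apply/eqP; rewrite -(eqr_nat R[i]) natrM; apply/eqP.
have <- : \sum_(f : V) \sum_(x in M) e (dot x f) = #|M|%:R * #|annihilator M|%:R.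
  rewrite mulr_natr -sumr_const [RHS]big_mkcond /=; apply: eq_bigr => f _.
  by rewrite (sum_character MZ) => [|x y]; rewrite ?dotDl // inE.
rewrite exchange_big /=.
have E (x : V) : \sum_f e (dot x f) = if x == 0 then #|{: V}|%:R else 0.
  have := @sum_character [set: V]%SET (dot x) setTZ.
  have -> : [forall f in [set: V]%SET, dot x f == 0] = (x == 0).
    by rewrite -annihilator_setT; apply: eq_forallb => f; rewrite inE.
  rewrite cardsT => <- => [|f g]; last by rewrite dotC dotDl !(dotC _ x).
  by apply: eq_bigl => f; rewrite inE.
rewrite (eq_bigr _ (fun x _ => E x)) (bigD1 (0 : V)) /= ?(MZ.1) // eqxx.
by rewrite big1 ?addr0 // => x /andP[_ /negPf ->].
Qed.

(** Subgroups of (Z_q)^I are determined by the functionals that vanish on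
    them: the two sides are nested, and have the same cardinality by the
    count above. *)
Lemma annihilatorK M : zmod_closed M -> annihilator (annihilator M) = M.
Proof.
move=> MZ; apply/esym/eqP; rewrite eqEcard; apply/andP; split.
  apply/fintype.subsetP => x xM; rewrite inE; apply/forall_inP => f; rewrite inE dotC.
  by move=> /forall_inP /(_ x xM).
have := card_annihilator (annihilator_zmod M).
rewrite -(card_annihilator MZ) mulnC => /eqP; rewrite eqn_pmul2r; first by move/eqP ->.
by rewrite card_gt0; apply/set0Pn; exists 0; exact: (annihilator_zmod M).1.
Qed.
End Characters.

(** * The cubical complex *)

(** The cancellation behind the vanishing of the square of a boundary operator:
    two directions can be removed or added in two orders, with opposite signs. *)
Lemma antisym_sum (A : zmodType) n (P : pred 'I_n) (F : 'I_n -> 'I_n -> A) :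
  (forall k l, P k -> P l -> k != l -> F k l = - F l k) ->
  \sum_(k | P k) \sum_(l | P l && (l != k)) F k l = 0.
Proof.
move=> FN.
rewrite (eq_bigr (fun k : 'I_n => \sum_(l | P l && (l < k)%N) F k l
                         + \sum_(l | P l && (k < l)%N) F k l)); last first.
  move=> k _; rewrite (bigID (fun l : 'I_n => (l < k)%N)) /=; congr (_ + _);
    apply: eq_bigl => l; rewrite -andbA; congr (_ && _); rewrite -(inj_eq val_inj) /=;
    by case: ltngtP.
rewrite big_split /=.
have -> : \sum_(k | P k) \sum_(l | P l && (k < l)%N) F k l =
          \sum_(k | P k) \sum_(l | P l && (l < k)%N) F l k.
  rewrite (exchange_big_dep P) /= => [|k l _ /andP[]//].
  by apply: eq_bigr => k Pk; apply: eq_bigl => l; rewrite Pk.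
rewrite -big_split big1 //= => k Pk.
rewrite -big_split big1 //= => l /andP[Pl lk].
by rewrite FN ?addNr // -(inj_eq val_inj) /= gtn_eqF.
Qed.

Section CubicalComplex.
Context {d : nat} {A : comNzRingType}.
Local Notation pos := {ffun 'I_d -> int}.
Implicit Types (x y : pos) (S : {set 'I_d}) (k l : 'I_d) (f : pos -> {set 'I_d} -> A).

Definition upd x k (a : int) : pos := [ffun l => if l == k then a else x l].

Lemma updE x k a l : upd x k a l = if l == k then a else x l.
Proof. by rewrite ffunE. Qed.

Lemma upd_id x k : upd x k (x k) = x.
Proof. by apply/ffunP => l; rewrite updE; case: eqP => [->|]. Qed.

Lemma upd_upd x k a b : upd (upd x k a) k b = upd x k b.
Proof. by apply/ffunP => l; rewrite !updE; case: eqP. Qed.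

Lemma updC x k l a b : k != l -> upd (upd x k a) l b = upd (upd x l b) k a.
Proof.
move=> kl; apply/ffunP => m; rewrite !updE; case: (eqVneq m l) => [->|//].
by rewrite eq_sym (negPf kl).
Qed.

(** The sign of direction k in the product orientation of a cube with directions S,
    as in the definition of the incidence numbers. *)
Definition sgn S k : A := (-1) ^+ #|[set l in S | (l < k)%N]%SET|.

Lemma sgn_sq S k : sgn S k * sgn S k = 1.
Proof. by rewrite -expr2 sqrr_sign. Qed.

Lemma sgnD1_id S k : sgn (S :\ k) k = sgn S k.
Proof.
rewrite /sgn; congr (_ ^+ #|pred_of_set _|); apply/setP => l; rewrite !inE.
by case: eqP => // ->; rewrite ltnn !andbF.
Qed.

Lemma sgnU1_id S k : sgn (k |: S) k = sgn S k.
Proof.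
rewrite /sgn; congr (_ ^+ #|pred_of_set _|); apply/setP => l; rewrite !inE.
by case: eqP => // ->; rewrite ltnn !andbF.
Qed.

Lemma sgnD1 S k l : k \in S -> k != l ->
  sgn (S :\ k) l = (if (k < l)%N then -1 else 1) * sgn S l.
Proof.
move=> kS kl; rewrite /sgn; case: ifP => [ltkl|nltkl].
  rewrite (cardsD1 k [set m in S | (m < l)%N]%SET) !inE kS ltkl exprS mulrA.
  rewrite mulrNN !mul1r; congr (_ ^+ #|pred_of_set _|); apply/setP => m.
  by rewrite !inE andbA.
rewrite mul1r; congr (_ ^+ #|pred_of_set _|); apply/setP => m; rewrite !inE.
by case: eqP => // ->; rewrite nltkl !andbF.
Qed.

Lemma sgnU1 S k l : k \notin S -> k != l ->
  sgn (k |: S) l = (if (k < l)%N then -1 else 1) * sgn S l.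
Proof.
move=> kS kl; rewrite -{2}(setU1K kS) sgnD1 ?setU11 // mulrA.
by case: ifP; rewrite ?mulrNN !mul1r.
Qed.

Lemma order_sign k l : k != l ->
  (if (k < l)%N then -1 else 1 : A) = - (if (l < k)%N then -1 else 1).
Proof. by rewrite -(inj_eq val_inj) /=; case: ltngtP => //; rewrite opprK. Qed.

(** Chains and cochains are treated here as functions of the corner x and the set S
    of directions of a cube, of any dimension and with any support.  The two
    cofaces of a cube in a direction k outside S, and its two faces in a direction
    k in S, are then explicit, and no finiteness is needed. *)
Definition bd f x S : A :=
  \sum_(k | k \notin S) sgn S k * (f (upd x k (x k - 1)) (k |: S) - f x (k |: S)).

Definition cbd f x S : A :=
  \sum_(k in S) sgn S k * (f (upd x k (x k + 1)) (S :\ k) - f x (S :\ k)).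

Lemma bdD f g x S : bd (fun x S => f x S + g x S) x S = bd f x S + bd g x S.
Proof. by rewrite /bd -big_split; apply: eq_bigr => k _ /=; ring. Qed.

Lemma bdB f g x S : bd (fun x S => f x S - g x S) x S = bd f x S - bd g x S.
Proof. by rewrite /bd -sumrB; apply: eq_bigr => k _ /=; ring. Qed.

Lemma eq_bd f g : (forall x S, f x S = g x S) -> forall x S, bd f x S = bd g x S.
Proof. by move=> fg x S; apply: eq_bigr => k _; rewrite !fg. Qed.

Lemma setU1C S k l : k |: (l |: S) = l |: (k |: S).
Proof. by apply/setP => m; rewrite !inE orbCA. Qed.

Lemma setD1C S k l : S :\ k :\ l = S :\ l :\ k.
Proof. by apply/setP => m; rewrite !inE andbCA. Qed.

Lemma bd_bd f x S : bd (bd f) x S = 0.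
Proof.
rewrite {1}/bd.
pose G k l := f (upd (upd x k (x k - 1)) l (x l - 1)) (l |: (k |: S))
  - f (upd x k (x k - 1)) (l |: (k |: S)) - f (upd x l (x l - 1)) (l |: (k |: S))
  + f x (l |: (k |: S)).
have GC k l : k != l -> G k l = G l k.
  by move=> kl; rewrite /G (updC _ _ _ kl) (setU1C S l k); ring.
rewrite (eq_bigr (fun k => \sum_(l | (l \notin S) && (l != k))
    sgn S k * sgn (k |: S) l * G k l)); last first.
  move=> k kS; rewrite /bd -sumrB mulr_sumr; apply: eq_big => [l|l].
    by rewrite !inE negb_or andbC.
  rewrite !inE negb_or => /andP[lk _].
  rewrite /G !updE (negPf lk); ring.
apply: antisym_sum => k l kS lS kl.
rewrite (GC _ _ kl) !sgnU1 // 1?eq_sym // (order_sign kl); ring.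
Qed.

Lemma cbd_cbd f x S : cbd (cbd f) x S = 0.
Proof.
rewrite {1}/cbd.
pose G k l := f (upd (upd x k (x k + 1)) l (x l + 1)) (S :\ k :\ l)
  - f (upd x k (x k + 1)) (S :\ k :\ l) - f (upd x l (x l + 1)) (S :\ k :\ l)
  + f x (S :\ k :\ l).
have GC k l : k != l -> G k l = G l k.
  by move=> kl; rewrite /G (updC _ _ _ kl) (setD1C S l k); ring.
rewrite (eq_bigr (fun k => \sum_(l | (l \in S) && (l != k))
    sgn S k * sgn (S :\ k) l * G k l)); last first.
  move=> k kS; rewrite /cbd -sumrB mulr_sumr; apply: eq_big => [l|l].
    by rewrite !inE andbC.
  rewrite !inE => /andP[lk _].
  rewrite /G !updE (negPf lk); ring.
apply: antisym_sum => k l kS lS kl.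
rewrite (GC _ _ kl) !sgnD1 // 1?eq_sym // (order_sign kl); ring.
Qed.

End CubicalComplex.

(** * Homology of the cube and of its boundary *)

Section Homotopy.
Context {d : nat} {A : comNzRingType} (N : nat).
Local Notation pos := {ffun 'I_d -> int}.
Implicit Types (x y : pos) (S : {set 'I_d}) (k l : 'I_d) (f g b : pos -> {set 'I_d} -> A).

(** The predicates in_cube and on_cube_boundary of a cell unfold to these predicates
    of its corner and its directions. *)
Definition in_box x S : bool :=
  [forall k, (- N%:Z <= x k) && (x k + (k \in S)%:Z <= N%:Z)].

Definition on_box x S : bool :=
  in_box x S && [exists k, (k \notin S) && (`|x k| == N%:Z)].

Lemma in_boxP x S :
  reflect (forall k, - N%:Z <= x k /\ x k + (k \in S)%:Z <= N%:Z) (in_box x S).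
Proof.
by apply: (iffP forallP) => h k; [have /andP := h k | apply/andP; exact: h].
Qed.

Definition supported (C : pos -> {set 'I_d} -> bool) f :=
  forall x S, ~~ C x S -> f x S = 0.

Local Notation of_dim j := (fun (_ : pos) (S : {set 'I_d}) => #|S| == j).

(** The chain homotopy that pushes a chain in the cube of size N in direction k down
    to the lower face: a cube at height a in this direction sweeps out the cubes
    below it.  The sum is over heights up to more than x_k + 2 N, so for a chain in
    the cube it contains all heights above x_k. *)
Definition prism k f x S : A :=
  if (k \in S) && (- N%:Z <= x k) then
    sgn S k * \sum_(m < N.*2.+1) f (upd x k (x k + 1 + m%:Z)) (S :\ k)
  else 0.

(** The end of this homotopy; a cube that extends in direction k is collapsed. *)
Definition project k f x S : A :=
  if (k \notin S) && (x k == - N%:Z) then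
    \sum_(m < N.*2.+2) f (upd x k (x k + m%:Z)) S
  else 0.

Lemma telescope_coord f x S k : supported in_box f -> - N%:Z <= x k ->
  \sum_(m < N.*2.+1) (f (upd x k (x k + m%:Z)) S - f (upd x k (x k + 1 + m%:Z)) S)
  = f x S.
Proof.
move=> fN xk.
pose g m := f (upd x k (x k + m%:Z)) S.
rewrite (eq_bigr (fun m : 'I__ => - (g m.+1 - g m))) => [|m _]; last first.
  rewrite /g opprB; congr (_ - f (upd x k _) S); lia.
rewrite sumrN -(big_mkord xpredT (fun m => g m.+1 - g m)) telescope_sumr //.
rewrite /g [X in X - _]fN ?addr0 ?upd_id ?sub0r ?opprK //.
apply/in_boxP => /(_ k); rewrite updE eqxx; lia.
Qed.

(** In direction k the sums telescope.  In all other directions the boundary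
    commutes with the prism operator up to sign, and the signs are opposite because
    the directions are removed and added in a different order. *)
Lemma homotopy k f x S : supported in_box f ->
  bd (prism k f) x S + prism k (bd f) x S + project k f x S = f x S.
Proof.
move=> fN; have [kS|kS] := boolP (k \in S); last first.
  rewrite {2}/prism (negPf kS) addr0 {1}/bd (bigD1 k) //= big1 ?addr0; last first.
    move=> l /andP[lS lk]; rewrite /prism !inE (negPf kS) eq_sym (negPf lk) /=.
    by rewrite subrr mulr0.
  rewrite /prism /project kS setU11 /= !updE eqxx setU1K // sgnU1_id.
  have [xk|xk] := leP (- N%:Z) (x k); last first.
    have -> : (- N%:Z <= x k - 1) = false by apply/negP; lia.
    have -> : (x k == - N%:Z) = false by apply/negP => /eqP; lia.
    rewrite subrr mulr0 addr0 fN //; apply/in_boxP => /(_ k); lia.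
  case: (eqVneq (x k)) => [xE|xN].
    have -> : (- N%:Z <= x k - 1) = false by apply/negP; lia.
    rewrite sub0r mulrN mulrA sgn_sq mul1r [X in _ + X]big_ord_recl /= [_ + 0%Z]addr0 upd_id addrC.
    rewrite -addrA -[RHS]addr0; congr (_ + _); rewrite -sumrB big1 // => m _.
    rewrite /bump /=; apply/eqP; rewrite subr_eq0; apply/eqP; congr (f (upd x k _) S).
    lia.
  have -> : (- N%:Z <= x k - 1) = true by lia.
  rewrite -mulrBr mulrA sgn_sq mul1r addr0 -sumrB -[RHS](@telescope_coord f x S k) //.
  apply: eq_bigr => m _; congr (_ - _); rewrite upd_upd; congr (f (upd x k _) S); lia.
rewrite /project kS addr0 {2}/prism kS /=.
have [xk|xk] := leP (- N%:Z) (x k); last first.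
  rewrite addr0 fN; last by apply/in_boxP => /(_ k); lia.
  rewrite /bd big1 // => l lS; have lk : l != k by apply: contraNneq lS => ->.
  rewrite /prism !updE [k == l]eq_sym (negPf lk) lt_geF ?andbF ?subrr ?mulr0 //.
have E m : bd f (upd x k (x k + 1 + m%:Z)) (S :\ k) =
   sgn S k * (f (upd x k (x k + m%:Z)) S - f (upd x k (x k + 1 + m%:Z)) S) +
   \sum_(l | l \notin S) sgn (S :\ k) l *
    (f (upd (upd x k (x k + 1 + m%:Z)) l (x l - 1)) (l |: (S :\ k))
     - f (upd x k (x k + 1 + m%:Z)) (l |: (S :\ k))).
  rewrite /bd (bigD1 k) ?setD11 //= sgnD1_id finset.setD1K // upd_upd updE eqxx.
  congr (_ * (f (upd x k _) S - _) + _); first by lia.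
  apply: eq_big => [l|l]; rewrite !inE negb_and negbK.
    by have [->|] := eqVneq l k; rewrite ?kS // andbT.
  by move=> /andP[_ lk]; rewrite updE (negPf lk).
under [X in _ + sgn S k * X]eq_bigr => m _ do rewrite E.
rewrite big_split /= -mulr_sumr telescope_coord // mulrDr mulrA sgn_sq mul1r.
rewrite addrCA -[RHS]addr0; congr (_ + _).
rewrite exchange_big mulr_sumr /= /bd -big_split big1 //= => l lS.
have lk : l != k by apply: contraNneq lS => ->.
rewrite /prism !inE kS orbT !updE [k == l]eq_sym (negPf lk) xk /=.
have SE : (l |: S) :\ k = l |: (S :\ k).
  by apply/setP => m; rewrite !inE; case: (eqVneq m k) => // ->; rewrite eq_sym (negPf lk).
rewrite SE -mulr_sumr sumrB.
under eq_bigr => m _ do rewrite (updC _ _ _ lk).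
rewrite (sgnU1 lS lk) (sgnD1 kS) 1?eq_sym // (order_sign lk); ring.
Qed.

Lemma on_in_box x S : on_box x S -> in_box x S.
Proof. by case/andP. Qed.

Lemma on_boxPn x S k : in_box x S -> ~~ on_box x S -> k \notin S -> `|x k| != N%:Z.
Proof.
move=> xN; rewrite /on_box xN /= negb_exists => /forallP /(_ k).
by rewrite negb_and => + kS; rewrite kS.
Qed.

Lemma bd_in_box f : supported in_box f -> supported in_box (bd f).
Proof.
move=> fN x S xN; rewrite /bd big1 // => k kS.
suff H y : y = x \/ y = upd x k (x k - 1) -> f y (k |: S) = 0.
  by rewrite !H ?subrr ?mulr0; [|left|right].
move=> yE; apply: fN; apply: contra xN => /in_boxP yN; apply/in_boxP => l.
have := yN l; have := yN k; rewrite !inE eqxx /=.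
case: (eqVneq l k) => [->|lk]; rewrite ?(negPf kS) ?eqxx //=.
  by case: yE => ->; rewrite ?updE ?eqxx; lia.
by case: yE => ->; rewrite ?updE ?(negPf lk).
Qed.

(** A face of a cube on the boundary of the large cube lies there too, since the
    direction in which the boundary is touched remains transversal. *)
Lemma bd_on_box f : supported on_box f -> supported on_box (bd f).
Proof.
move=> fN x S; have [xN|xN] := boolP (in_box x S); last first.
  by move=> _; rewrite bd_in_box // => y T yT; apply: fN; apply: contra yT => /on_in_box.
move=> xN'; rewrite /bd big1 // => k kS.
suff H y : y = x \/ y = upd x k (x k - 1) -> f y (k |: S) = 0.
  by rewrite !H ?subrr ?mulr0; [|left|right].
move=> yE; apply: fN; rewrite negb_and; apply/orP; right.
rewrite negb_exists; apply/forallP => l; rewrite !inE negb_or -andbA negb_and negbK.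
case: (eqVneq l k) => //= lk; rewrite negb_and negbK; case: (boolP (l \in S)) => //= lS.
have := on_boxPn xN xN' lS.
by case: yE => ->; rewrite ?updE ?(negPf lk).
Qed.

Lemma bd_of_dim j f : supported (of_dim j.+1) f -> supported (of_dim j) (bd f).
Proof.
move=> fj x S Sj; rewrite /bd big1 // => k kS.
by rewrite !fj ?subrr ?mulr0 // cardsU1 kS add1n eqSS.
Qed.

Lemma prism_in_box k f : supported in_box f -> supported in_box (prism k f).
Proof.
move=> fN x S xN; rewrite /prism; case: ifP => // /andP[kS xk].
rewrite big1 ?mulr0 // => m _; apply: fN; apply: contra xN => /in_boxP yN.
apply/in_boxP => l; have := yN l; rewrite updE !inE.
by case: (eqVneq l k) => [->|//]; rewrite kS /=; lia.
Qed.

Lemma prism_of_dim j k f : supported (of_dim j) f -> supported (of_dim j.+1) (prism k f).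
Proof.
move=> fj x S Sj; rewrite /prism; case: ifP => // /andP[kS xk].
by rewrite big1 ?mulr0 // => m _; apply: fj; move: Sj; rewrite (cardsD1 k S) kS.
Qed.

(** For a cycle the homotopy formula makes the difference to its projection a
    boundary, so the cycle can be pushed down in one direction after the other. *)
Lemma collapse_cycle j g (s : seq 'I_d) :
  supported in_box g -> supported (of_dim j) g -> (forall x S, bd g x S = 0) ->
  exists b, [/\ supported in_box b, supported (of_dim j.+1) b &
    supported (fun x S => all (fun k => (k \notin S) && (x k == - N%:Z)) s)
      (fun x S => g x S - bd b x S)].
Proof.
move=> gN gj dg; elim: s => [|k s [b [bN bj bs]]].
  by exists (fun _ _ => 0).
pose g1 x S := g x S - bd b x S.
have g1N : supported in_box g1 by move=> x S xN; rewrite /g1 gN // bd_in_box // subrr.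
have g1j : supported (of_dim j) g1 by move=> x S xN; rewrite /g1 gj // (bd_of_dim bj) // subrr.
have dg1 x S : bd g1 x S = 0 by rewrite bdB dg bd_bd subrr.
exists (fun x S => b x S + prism k g1 x S); split.
- by move=> x S xN; rewrite bN // prism_in_box // addr0.
- by move=> x S xN; rewrite bj // (prism_of_dim _ g1j) // addr0.
move=> x S /=; rewrite bdD opprD addrA -/(g1 x S) -(homotopy k _ _ g1N).
have -> : prism k (bd g1) x S = 0.
  by rewrite /prism; case: ifP => // _; rewrite big1 ?mulr0.
rewrite addr0 addrAC subrr add0r /project; case: ifP => //= kx ns.
by rewrite big1 // => m _; apply: bs; apply: contra ns => /allP h; apply/allP => l /[dup] ls /h;
  rewrite updE; case: (eqVneq l k) => [->|].
Qed.

Definition lowest_corner : pos := [ffun=> - N%:Z].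

(** The cube is contractible: a cycle pushed down in all directions is concentrated
    in the lowest corner.  The remaining multiple v of this point vanishes in positive
    dimension, and in dimension 0 for reduced cycles. *)
Lemma fill_box j g :
  supported in_box g -> supported (of_dim j) g -> (forall x S, bd g x S = 0) ->
  exists b v, [/\ supported in_box b, supported (of_dim j.+1) b &
    forall x S, bd b x S = g x S - (if (x == lowest_corner) && (S == finset.set0) then v else 0)].
Proof.
move=> gN gj dg; have [b [bN bj bs]] := collapse_cycle (enum 'I_d) gN gj dg.
exists b, (g lowest_corner (finset.set0) - bd b lowest_corner (finset.set0)); split=> // x S.
case: ifP => [/andP[/eqP -> /eqP ->]|xS]; first by rewrite subKr.
apply/eqP; rewrite subr0 eq_sym -subr_eq0; apply/eqP/bs.
apply: contraFN xS => /allP h; apply/andP; split.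
  by apply/eqP/ffunP => k; rewrite ffunE; have /andP[_ /eqP] := h k (mem_enum _ _).
by apply/eqP/setP => k; rewrite inE; apply/negP; have /andP[/negP] := h k (mem_enum _ _).
Qed.

(** Subtract the boundary of the prism, in one more direction k, over the part of the
    chain inside the cube.  By the homotopy formula, what remains of a cell that does
    not extend in direction k lies in a face of the cube.  So in the end the cells
    inside the cube extend in all directions of s. *)
Lemma push_to_boundary j b (s : seq 'I_d) :
  supported in_box b -> supported (of_dim j) b -> supported on_box (bd b) ->
  exists c, [/\ supported in_box c, supported (of_dim j) c,
    supported (fun x S => on_box x S || all (fun k => k \in S) s) c &
    forall x S, bd c x S = bd b x S].
Proof.
move=> bN bj dbN; elim: s => [|k s [f [fN fj fs df]]].
  by exists b; split=> // x S; rewrite orbT.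
pose h x S := if on_box x S then 0 else f x S.
have hN : supported in_box h by move=> x S xN; rewrite /h; case: ifP => // _; exact: fN.
have hj : supported (of_dim j) h by move=> x S xN; rewrite /h; case: ifP => // _; exact: fj.
have hs : supported (fun x S => all (fun k => k \in S) s) h.
  by move=> x S xN; rewrite /h; case: ifP => // nx; rewrite fs // nx.
have dhN : supported on_box (bd h).
  move=> x S xN; have -> : bd h x S = bd f x S - bd (fun x S => f x S - h x S) x S.
    by rewrite -bdB; apply: eq_bd => y T; rewrite subKr.
  rewrite df dbN // bd_on_box ?subrr // => y T yN.
  by rewrite /h (negPf yN) subrr.
exists (fun x S => f x S - bd (prism k h) x S); split.
- by move=> x S xN; rewrite fN // bd_in_box ?subrr //; exact: prism_in_box.
- move=> x S xN; rewrite fj // (@bd_of_dim j) ?subrr //.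
  exact: prism_of_dim.
- move=> x S; rewrite negb_or => /andP[xN ns].
  have [xin|xout] := boolP (in_box x S); last first.
    by rewrite fN // bd_in_box ?subrr //; exact: prism_in_box.
  have -> : f x S = h x S by rewrite /h (negPf xN).
  have -> : h x S - bd (prism k h) x S = prism k (bd h) x S + project k h x S.
    by rewrite -{1}(homotopy k x S hN); ring.
  have -> : project k h x S = 0.
    rewrite /project; case: ifP => // /andP[kS /eqP xk].
    by have := on_boxPn xin xN kS; rewrite xk normrN; lia.
  rewrite addr0 /prism; case: ifP => // /andP[kS xk].
  rewrite big1 ?mulr0 // => m _.
  set y := upd x k _.
  have [yN|] := boolP (on_box y (S :\ k)); last exact: dhN.
  have [yin /existsP[l /andP[lS ly]]] := andP yN.
  (* The only face of the cube that y can lie on is the upper one in direction k,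
     for otherwise x would lie on a face too. *)
  have lk : l = k.
    apply: contraTeq ly => lk; rewrite updE (negPf lk); apply: (on_boxPn xin xN).
    by move: lS; rewrite !inE lk.
  have yk : y k = N%:Z by move: ly; rewrite lk updE eqxx; lia.
  have hS z : h z S = 0 by apply: hs; move: ns; rewrite /= kS.
  rewrite /bd big1 // => l' l'S.
  have [->|l'k] := eqVneq l' k; first by rewrite finset.setD1K // !hS subrr mulr0.
  suff H (z : pos) : z k = N%:Z -> h z (l' |: (S :\ k)) = 0.
    by rewrite !H ?subrr ?mulr0 // updE eq_sym (negPf l'k).
  move=> zk; have [zin|/hN//] := boolP (in_box z (l' |: (S :\ k))).
  rewrite /h; case: ifP => // /negP[]; rewrite /on_box zin /=.
  by apply/existsP; exists k; rewrite !inE eqxx eq_sym (negPf l'k) zk /=; lia.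
- by move=> x S; rewrite bdB bd_bd subr0.
Qed.

(** The boundary of the cube is a (d-1)-sphere: it has no homology below
    dimension d-1.  Fill a cycle inside the cube; as the filling has dimension less
    than d, none of its cells extends in all directions, so it can be pushed to the
    boundary. *)
Lemma fill_sphere j g : (j.+1 < d)%N ->
  supported on_box g -> supported (of_dim j) g -> (forall x S, bd g x S = 0) ->
  exists b v, [/\ supported on_box b, supported (of_dim j.+1) b &
    forall x S, bd b x S = g x S - (if (x == lowest_corner) && (S == finset.set0) then v else 0)].
Proof.
move=> jd gN gj dg.
have gin : supported in_box g.
  by move=> x S xN; apply: gN; apply: contra xN => /on_in_box.
have [b [v [bN bj db]]] := fill_box gin gj dg.
have dbN : supported on_box (bd b).
  move=> x S xN; rewrite db gN //; case: ifP => [|_]; last by rewrite subrr.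
  case/andP => /eqP xE /eqP SE; move: xN; rewrite xE SE => /negP[].
  apply/andP; split; first by apply/in_boxP => k; rewrite ffunE inE; lia.
  apply/existsP; exists (Ordinal (ltn_trans (ltn0Sn _) jd)).
  by rewrite inE ffunE normrN /=; lia.
have [c [cN cj cs dc]] := push_to_boundary (enum 'I_d) bN bj dbN.
exists c, v; split=> // [x S xN|x S]; last by rewrite dc.
have [/eqP Sj|] := boolP (#|S| == j.+1); last exact: cj.
apply: cs; rewrite (negPf xN) /=; apply/negP => /allP h.
have : (d <= #|S|)%N.
  by rewrite -{1}(card_ord d); apply/subset_leq_card/fintype.subsetP => k _; rewrite h ?mem_enum.
by rewrite Sj leqNgt jd.
Qed.

Definition clamp (a : int) : int := Num.max (- N%:Z) (Num.min a N%:Z).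

(** Clamping all coordinates is a retraction onto the cube that maps each cell to a
    cell or collapses it; this is the pullback of a cochain by this retraction. *)

Definition retract f x S : A :=
  if [forall k in S, (- N%:Z <= x k) && (x k + 1 <= N%:Z)]
  then f [ffun k => clamp (x k)] S else 0.

(** Pullback by a cellular map commutes with the coboundary. *)
Lemma cbd_retract f x S : cbd (retract f) x S = retract (cbd f) x S.
Proof.
pose ok k := (- N%:Z <= x k) && (x k + 1 <= N%:Z).
rewrite [RHS]/retract; case: ifP => [/forall_inP okS|nokS].
  apply: eq_bigr => k kS; have := okS k kS => okk.
  rewrite /retract; have -> : [forall l in S :\ k, ok l].
    by apply/forall_inP => l; rewrite inE => /andP[_]; exact: okS.
  have -> : [forall l in S :\ k, (- N%:Z <= upd x k (x k + 1) l) &&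
      (upd x k (x k + 1) l + 1 <= N%:Z)].
    by apply/forall_inP => l; rewrite !inE updE => /andP[/negPf ->]; exact: okS.
  congr (_ * (f _ _ - _)); apply/ffunP => l; rewrite updE !ffunE.
  by case: eqP => _ //; rewrite /clamp; lia.
rewrite /cbd big1 // => k kS.
suff -> : retract f (upd x k (x k + 1)) (S :\ k) = retract f x (S :\ k).
  by rewrite subrr mulr0.
rewrite /retract.
have -> : [forall l in S :\ k, (- N%:Z <= upd x k (x k + 1) l) &&
      (upd x k (x k + 1) l + 1 <= N%:Z)] = [forall l in S :\ k, ok l].
  apply: eq_forallb => l; rewrite updE !inE; by case: (eqVneq l k).
case: ifP => // /forall_inP okSk.
(* The direction k is collapsed, so both faces have the same image. *)
have /negP nokk : ~~ ok k.
  apply/negP => okk; move/negP: nokS; apply; apply/forall_inP => l lS.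
  by case: (eqVneq l k) => [->//|lk]; apply: okSk; rewrite !inE lk.
congr (f _ _); apply/ffunP => l; rewrite !ffunE.
case: (eqVneq l k) => [->|//]; move: nokk; rewrite /ok /clamp; lia.
Qed.
End Homotopy.

(** * Chains and cochains in a cube *)

Section Raw.
Context {d : nat} {A : comNzRingType}.
Local Notation pos := {ffun 'I_d -> int}.

(** Extension by zero to the cubes of all dimensions. *)
Definition raw {j} (f : cell d j -> A) (x : pos) (S : {set 'I_d}) : A :=
  if insub (x, S) is Some s then f s else 0.

Lemma raw_cell j (f : cell d j -> A) (s : cell d j) :
  raw f (corner s) (dirs s) = f s.
Proof. by rewrite /raw /corner /dirs -surjective_pairing valK. Qed.

Lemma raw_of_dim j (f : cell d j -> A) :
  supported (fun _ S => #|S| == j) (raw f).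
Proof. by move=> x S xS; rewrite /raw insubN. Qed.

Lemma rawP j (f : cell d j -> A) x S :
  raw f x S = 0 \/ exists s, [/\ x = corner s, S = dirs s & raw f x S = f s].
Proof.
rewrite /raw; case: insubP => [s _ sE|_]; [right|by left].
by exists s; rewrite /corner /dirs sE.
Qed.

Lemma raw_sum j (f : cell d j -> A) (r : seq (cell d j)) x S :
  uniq r -> (forall s, s \notin r -> f s = 0) ->
  raw f x S = \sum_(s <- r) f s * (val s == (x, S))%:R.
Proof.
move=> r_uniq fr; rewrite /raw; case: insubP => [s _ sE|xS]; last first.
  rewrite big1 // => s _; case: eqP => [sE|]; last by rewrite mulr0.
  by move: xS; rewrite -sE (valP s).
have [sr|sr] := boolP (s \in r); last first.
  rewrite fr // big_seq big1 // => u ur; rewrite -sE (inj_eq val_inj).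
  by case: eqP => [us|_]; [rewrite -us ur in sr|rewrite mulr0].
rewrite (bigD1_seq s) //= sE eqxx mulr1 big1 ?addr0 // => u us.
by rewrite -sE (inj_eq val_inj) (negPf us) mulr0.
Qed.

Lemma incidence_cbd j j' (s : cell d j) (t : cell d j') :
  (incidence s t)%:~R = cbd (fun x S => (val t == (x, S))%:R) (corner s) (dirs s) :> A.
Proof.
rewrite /incidence rmorph_sum; apply: eq_bigr => k ks.
rewrite rmorphM rmorphB /= rmorphXn rmorphN1; congr (_ * (_ - _)).
rewrite /upper_face; set y := finfun _; have -> : y = upd (corner s) k (corner s k + 1).
  by apply/ffunP => l; rewrite updE !ffunE; case: eqP => [->|]; rewrite ?addr0.
by [].
Qed.

(** The incidence number is a coboundary in the second cell and a boundary in the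
    first: t is the upper or lower face of s in direction k exactly when s is the
    corresponding coface of t. *)
Lemma incidence_bd j j' (s : cell d j) (t : cell d j') :
  (incidence s t)%:~R = bd (fun x S => (val s == (x, S))%:R) (corner t) (dirs t) :> A.
Proof.
rewrite incidence_cbd /cbd /bd big_mkcond [RHS]big_mkcond; apply: eq_bigr => k _ /=.
rewrite /corner /dirs; case: s => -[y T] sT; case: t => -[x S] tS /=.
have NS (u v : pos) (U : {set 'I_d}) : k \notin S -> k \notin T ->
    ((v, T) == (u, k |: U)) = false.
  by move=> _ kT; apply/negP => /eqP[_ TE]; move: kT; rewrite TE setU11.
have NT (u v : pos) (U : {set 'I_d}) : k \in S -> ((v, S) == (u, U :\ k)) = false.
  by move=> kS; apply/negP => /eqP[_ SE]; move: kS; rewrite SE setD11.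
have [kT|kT] := boolP (k \in T); have [kS|kS] := boolP (k \in S) => /=.
- by rewrite !NT // subrr mulr0.
- have ET (u v : pos) : ((v, S) == (u, T :\ k)) = ((u, T) == (v, k |: S)).
    apply/eqP/eqP => -[-> ->]; first by rewrite finset.setD1K.
    by rewrite setU1K.
  rewrite !ET; have [TE|TN] := eqVneq T (k |: S); last first.
    have N0 (u v : pos) : ((u, T) == (v, k |: S)) = false.
      by apply/negP => /eqP[_ TE]; rewrite TE eqxx in TN.
    by rewrite !N0 subrr !mulr0.
  have -> : sgn T k = sgn S k :> A by rewrite TE sgnU1_id.
  have -> // : ((upd y k (y k + 1), T) == (x, k |: S)) =
               ((y, T) == (upd x k (x k - 1), k |: S)).
  apply/eqP/eqP => -[E F]; rewrite -F; congr (_, _); apply/ffunP => l.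
    by rewrite -E !updE eqxx addrK; case: eqP => [->|].
  by rewrite E !updE eqxx subrK; case: eqP => [->|].
- by [].
- by rewrite !NS // subrr mulr0.
Qed.

End Raw.

Section Chains.
Context {d q : nat}.
Local Notation pos := {ffun 'I_d -> int}.

Lemma fsfun_notin j (b : chain d q j) s : s \notin finsupp b -> b s = 0.
Proof. by move=> sb; rewrite fsfun_dflt. Qed.

Lemma boundary_bd j j' (b : chain d q j) (t : cell d j') :
  boundary b t = bd (raw b) (corner t) (dirs t).
Proof.
rewrite /boundary /bd.
under [RHS]eq_bigr => k _ do
  rewrite !(raw_sum _ _ (fset_uniq (finsupp b)) (@fsfun_notin _ b)) -sumrB mulr_sumr.
rewrite exchange_big; apply: eq_bigr => s _.
rewrite -mulrzr incidence_bd /bd mulr_sumr; apply: eq_bigr => k _; ring.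
Qed.

Lemma PLGT_extend_in N j (f : cochain d q N j) (t : cells_in_cube d N j) :
  @PLGT_extend d q j.+1 N f (val t) = f t.
Proof. by rewrite /PLGT_extend valK. Qed.

Lemma PLGT_extend_out N j (f : cochain d q N j) (t : cell d j) :
  t \notin cells_in_cube d N j -> @PLGT_extend d q j.+1 N f t = 0.
Proof. by move=> tN; rewrite /PLGT_extend insubN. Qed.

Lemma coboundary_cbd N j j' (f : cochain d q N j) (s : cell d j') :
  coboundary f s = cbd (raw (@PLGT_extend d q j.+1 N f)) (corner s) (dirs s).
Proof.
rewrite /coboundary /cbd.
under [RHS]eq_bigr => k _ do
  rewrite !(raw_sum _ _ (fset_uniq (cells_in_cube d N j)) (@PLGT_extend_out N j f))
    -sumrB mulr_sumr.
rewrite exchange_big [RHS]big_seq_fsetE /=; apply: eq_bigr => t _.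
rewrite -mulrzr incidence_cbd /cbd mulr_sumr; apply: eq_bigr => k _.
rewrite PLGT_extend_in; ring.
Qed.

Lemma summation_by_parts N j j' (f : cochain d q N j) (b : chain d q j') :
  \sum_(s <- finsupp b) b s * coboundary f s =
  \sum_(t : cells_in_cube d N j) f t * boundary b (val t).
Proof.
under eq_bigr => s _ do rewrite mulr_sumr.
rewrite exchange_big; apply: eq_bigr => t _.
rewrite /boundary mulr_sumr; apply: eq_bigr => s _.
by rewrite !mulrzAr mulrC.
Qed.

Lemma sum_finsupp j (g : chain d q j) (C : {fset cell d j}) (F : cell d j -> 'Z_q) :
  (forall t, t \in finsupp g -> t \in C) ->
  \sum_(t <- finsupp g) g t * F t = \sum_(t : C) g (val t) * F (val t).
Proof.
move=> gC; rewrite -[RHS](big_seq_fsetE _ _ xpredT (fun t => g t * F t)) /=.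
apply: big_fset_incl; first exact/fsubsetP.
by move=> t _ /fsfun_notin ->; rewrite mul0r.
Qed.
End Chains.

Section Cycles.
Context {d q : nat}.
Local Notation pos := {ffun 'I_d -> int}.
Local Notation ext := (@PLGT_extend d q _.+1 _).

Lemma in_inner_cells N j (s : cell d j) :
  (s \in inner_cells d N j) = in_cube N s && ~~ on_cube_boundary N s.
Proof. by rewrite !inE /= in_cells_in_cube. Qed.

Lemma in_boundary_cells N j (s : cell d j) :
  (s \in boundary_cells d N j) = on_cube_boundary N s.
Proof.
rewrite !inE /= in_cells_in_cube; apply/andP/idP => [[]//|sN].
by split=> //; case/andP: sN.
Qed.

Definition chain_on {j} (Q : {fset cell d j}) (F : cell d j -> 'Z_q) : chain d q j :=
  [fsfun s in Q => F s].

Lemma chain_onE j (Q : {fset cell d j}) F s :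
  chain_on Q F s = if s \in Q then F s else 0.
Proof. by rewrite /chain_on fsfunE. Qed.

Lemma finsupp_chain_on j (Q : {fset cell d j}) F s :
  s \in finsupp (chain_on Q F) -> s \in Q.
Proof. by rewrite mem_finsupp chain_onE; case: ifP => //; rewrite eqxx. Qed.

Lemma raw_supported C j (f : cell d j -> 'Z_q) :
  (forall s, ~~ C (corner s) (dirs s) -> f s = 0) -> supported C (raw f).
Proof.
move=> fC x S xS; case: (rawP f x S) => // -[s [xE SE ->]].
by apply: fC; rewrite -xE -SE.
Qed.

Lemma raw_chain_on C j (Q : {fset cell d j}) (F : pos -> {set 'I_d} -> 'Z_q) :
  supported C F -> supported (fun _ S => #|S| == j) F ->
  (forall s : cell d j, C (corner s) (dirs s) -> s \in Q) ->
  forall x S, raw (chain_on Q (fun s => F (corner s) (dirs s))) x S = F x S.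
Proof.
move=> FC Fj CQ x S; rewrite /raw; case: insubP => [s _ sE|xS]; last by rewrite Fj.
rewrite chain_onE /corner /dirs sE /=; case: ifP => // /negP sQ.
by rewrite FC //; apply/negP => xC; apply: sQ; apply: CQ; rewrite /corner /dirs sE.
Qed.

Lemma face_cell N j (s : cell d j.+1) (k : 'I_d) (y : pos) :
  in_cube N s -> k \in dirs s ->
  y = corner s \/ y = upd (corner s) k (corner s k + 1) ->
  exists t : cell d j, [/\ in_cube N t, corner t = y & dirs t = dirs s :\ k]%SET.
Proof.
move=> sN ks yE.
have Hc : #|(y, dirs s :\ k).2| == j.
  by have := valP s; rewrite /= (cardsD1 k) -/(dirs s) ks.
exists (exist _ (y, dirs s :\ k) Hc); split=> //.
apply/forallP => l; rewrite /corner /dirs /= !inE; have /forallP := sN.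
move=> /(_ l); case: (eqVneq l k) => [->|lk].
  by rewrite ks; case: yE => ->; rewrite ?updE ?eqxx /=; lia.
by case: yE => ->; rewrite ?updE ?(negPf lk).
Qed.

(** A cell of the cube has all its faces in the cube, so its coboundary does not see
    how a cochain of the cube is extended. *)
Lemma coboundary_cochain N j (f : cochain d q N j) (g : pos -> {set 'I_d} -> 'Z_q)
    (s : cell d j.+1) :
  (forall t, f t = g (corner (val t)) (dirs (val t))) -> in_cube N s ->
  coboundary f s = cbd g (corner s) (dirs s).
Proof.
move=> fg sN; rewrite coboundary_cbd; apply: eq_bigr => k ks.
suff H y : y = corner s \/ y = upd (corner s) k (corner s k + 1) ->
    raw (ext f) y (dirs s :\ k) = g y (dirs s :\ k).
  by rewrite !H; [|left|right].
move=> yE; have [t [tN <- <-]] := face_cell sN ks yE; rewrite raw_cell.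
rewrite -in_cells_in_cube in tN.
by rewrite -[t]/(val (FSetSub tN)) PLGT_extend_in fg.
Qed.

(** In degree 0 the coboundaries are the constants, because of the augmentation;
    in positive degrees this is [cbd_cbd]. *)
Lemma coboundary_coboundaries N j (f : cochain d q N j) (s : cell d j.+1) :
  f \in coboundaries d q N j -> in_cube N s -> coboundary f s = 0.
Proof.
case: j f s => [|j] f s /imsetP[g _ ->] sN.
  rewrite (coboundary_cochain (g := fun _ _ => g)) // => [|t]; last by rewrite ffunE.
  by rewrite /cbd big1 // => k _; rewrite subrr mulr0.
rewrite (coboundary_cochain (g := cbd (raw (ext g)))) // => [|t].
  exact: cbd_cbd.
by rewrite ffunE coboundary_cbd.
Qed.

Lemma boundary_out N j j' (b : chain d q j) (t : cell d j') :
  (forall s, s \in finsupp b -> in_cube N s) -> ~~ in_cube N t -> boundary b t = 0.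
Proof.
move=> bN tN; rewrite boundary_bd (@bd_in_box _ _ N) //.
by apply: raw_supported => s sN; apply: fsfun_notin; apply: contra sN => /bN.
Qed.

(** By summation by parts.  In this form the augmentation in degree 0 needs no
    separate treatment. *)
Lemma is_cycleP N j (g : chain d q j) :
  (forall t, t \in finsupp g -> in_cube N t) ->
  is_cycle g <->
  (forall f, f \in coboundaries d q N j ->
    \sum_(t : cells_in_cube d N j) g (val t) * f t = 0).
Proof.
move=> gN.
have gN' t : t \in finsupp g -> t \in cells_in_cube d N j.
  by move=> /gN; rewrite in_cells_in_cube.
case: j g gN gN' => [|j] g gN gN' /=.
  have E a : \sum_(t : cells_in_cube d N 0) g (val t) * a = (\sum_(t <- finsupp g) g t) * a.
    by rewrite mulr_suml -(sum_finsupp (fun _ => a) gN').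
  split=> [g0 f /imsetP[a _ ->]|H].
    by under eq_bigr => t _ do rewrite ffunE; rewrite E g0 mul0r.
  have one : [ffun=> 1] \in coboundaries d q N 0 by apply/imsetP; exists 1.
  by have := H _ one; under eq_bigr => t _ do rewrite ffunE; rewrite E mulr1.
have E (f : cochain d q N j) :
    \sum_(t : cells_in_cube d N j.+1) g (val t) * coboundary f (val t) =
    \sum_(u : cells_in_cube d N j) f u * boundary g (val u).
  by rewrite -summation_by_parts -(sum_finsupp (fun t => coboundary f t) gN').
split=> [g0 f /imsetP[h _ ->]|H t].
  under eq_bigr => t _ do rewrite ffunE.
  by rewrite E big1 // => u _; rewrite g0 mulr0.
have [tN|tN] := boolP (t \in cells_in_cube d N j); last first.
  by apply: (boundary_out gN); rewrite -in_cells_in_cube.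
pose f : cochain d q N j := [ffun u => (u == FSetSub tN)%:R].
have := H [ffun t => coboundary f (val t)]; rewrite imset_f //.
move=> /(_ isT); under eq_bigr => u _ do rewrite ffunE.
rewrite E (bigD1 (FSetSub tN)) //= ffunE eqxx mul1r big1 ?addr0 // => u.
by rewrite ffunE => /negPf ->; rewrite mul0r.
Qed.

Lemma boundary_is_cycle N j (b : chain d q j.+1) (g : chain d q j) :
  (forall s, s \in finsupp b -> in_cube N s) ->
  (forall t, t \in finsupp g -> in_cube N t) ->
  (forall t : cell d j, boundary b t = g t) -> is_cycle g.
Proof.
move=> bN gN bg; apply/(is_cycleP gN) => f fB.
under eq_bigr => t _ do rewrite mulrC -bg.
rewrite -summation_by_parts big_seq big1 // => s /bN sN.
by rewrite coboundary_coboundaries ?mulr0.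
Qed.

Definition bounds {j} (Q : {fset cell d j.+1}) (g : chain d q j) : Prop :=
  exists2 b : chain d q j.+1, (forall s, s \in finsupp b -> s \in Q) &
    forall t : cell d j, boundary b t = g t.

(** The multiple of a point that [fill_sphere] leaves over is zero: in positive
    dimension a point is not a cell of the chain, and in dimension 0 both the cycle
    and the boundary have coefficient sum zero. *)
Lemma bounds_sphere N j (g : chain d q j) : (j.+1 < d)%N -> is_cycle g ->
  (forall t, t \in finsupp g -> on_cube_boundary N t) ->
  bounds (boundary_cells d N j.+1) g.
Proof.
move=> jd gZ gS.
have gN t : t \in finsupp g -> in_cube N t by move=> /gS /andP[].
have rgS : supported (@on_box d N) (raw g).
  by apply: raw_supported => s sN; apply: fsfun_notin; apply: contra sN => /gS.
have dg x S : bd (raw g) x S = 0.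
  have [Sj|Sj] := eqVneq #|S|.+1 j; last first.
    rewrite /bd big1 // => k kS; rewrite !raw_of_dim ?subrr ?mulr0 //;
    by apply: contra Sj => /eqP <-; rewrite cardsU1 kS.
  case: j Sj g gZ gS gN rgS jd => // j [/eqP Sj] g gZ gS gN rgS jd.
  pose t : cell d j := exist _ (x, S) Sj.
  by have := gZ t; rewrite boundary_bd.
have [b [v [bS bj db]]] := fill_sphere jd rgS (@raw_of_dim _ _ _ g) dg.
pose c := chain_on (boundary_cells d N j.+1) (fun s => b (corner s) (dirs s)).
have rc x S : raw c x S = b x S.
  by apply: (raw_chain_on bS bj) => s; rewrite in_boundary_cells.
have cS s : s \in finsupp c -> s \in boundary_cells d N j.+1 by exact: finsupp_chain_on.
have dc (t : cell d j) : boundary c t =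
    g t - (if (corner t == lowest_corner N) && (dirs t == finset.set0) then v else 0).
  by rewrite boundary_bd (eq_bd rc) db raw_cell.
exists c => // t; rewrite dc; case: ifP => [/andP[/eqP tb /eqP t0]|]; last by rewrite subr0.
have j0 : j = 0 by apply/eqP; rewrite -(eqP (valP t)) -/(dirs t) t0 cards0.
clearbody c; subst j.
have cN s : s \in finsupp c -> in_cube N s by move=> /cS; rewrite in_boundary_cells => /andP[].
pose g' := chain_on (cells_in_cube d N 0) (fun t => boundary c t).
have g'N t' : t' \in finsupp g' -> in_cube N t'.
  by move=> /finsupp_chain_on; rewrite in_cells_in_cube.
have g'E t' : boundary c t' = g' t'.
  rewrite chain_onE in_cells_in_cube; case: ifP => // /negP/negP; exact: boundary_out.
have g'Z := boundary_is_cycle cN g'N g'E.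
have one : [ffun=> 1] \in coboundaries d q N 0 by apply/imsetP; exists 1.
have tN : t \in cells_in_cube d N 0.
  by rewrite in_cells_in_cube; apply/forallP => k; rewrite tb t0 ffunE inE; lia.
have := (is_cycleP g'N).1 g'Z _ one; have := (is_cycleP gN).1 gZ _ one.
rewrite (bigD1 (FSetSub tN)) // [in X in _ -> X -> _](bigD1 (FSetSub tN)) //=.
rewrite -g'E dc tb t0 !eqxx /= ffunE mulr1.
have -> : \sum_(i | i != FSetSub tN) g' (val i) * [ffun=> 1] i =
          \sum_(i | i != FSetSub tN) g (val i) * [ffun=> 1] i.
  apply: eq_bigr => u ut; rewrite -g'E dc; case: ifP => [|_]; last by rewrite subr0.
  case/andP => /eqP ub /eqP u0; case/negP: ut; apply/eqP; apply: val_inj => /=.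
  by apply: val_inj; rewrite [LHS]surjective_pairing [RHS]surjective_pairing
    -!/(corner _) -!/(dirs _) ub u0 tb t0.
by rewrite mulr1 => E; rewrite addrAC E sub0r => ->; rewrite addr0.
Qed.
End Cycles.

(** * Bounding chains and cocycles *)

Section Bounding.
Context {d q : nat}.
Local Notation pos := {ffun 'I_d -> int}.

Lemma boundaryD j (b b1 b2 : chain d q j.+1) (t : cell d j) :
  (forall s, b s = b1 s + b2 s) -> boundary b t = boundary b1 t + boundary b2 t.
Proof.
move=> bE; rewrite !boundary_bd -bdD; apply: eq_bd => x S.
by rewrite /raw; case: insubP => [s _ _|_]; rewrite ?bE ?addr0.
Qed.

Lemma boundaryB j (b b1 b2 : chain d q j.+1) (t : cell d j) :
  (forall s, b s = b1 s - b2 s) -> boundary b t = boundary b1 t - boundary b2 t.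
Proof.
move=> bE; rewrite (@boundaryD _ b1 b b2) ?addrK // => s.
by rewrite bE subrK.
Qed.

(** In every transversal direction an interior cell has room on both sides. *)
Lemma coface_inner N (x y : pos) (S : {set 'I_d}) (k : 'I_d) :
  in_box N x S -> ~~ on_box N x S -> k \notin S ->
  y = x \/ y = upd x k (x k - 1) ->
  in_box N y (k |: S) && ~~ on_box N y (k |: S).
Proof.
move=> xin xN kS yE; apply/andP; split.
  apply/in_boxP => l; rewrite !inE; have /in_boxP /(_ l) := xin.
  have := on_boxPn xin xN kS; case: (eqVneq l k) => [->|lk] /=.
    by rewrite (negPf kS); case: yE => ->; rewrite ?updE ?eqxx; lia.
  by case: yE => ->; rewrite ?updE ?(negPf lk).
rewrite negb_and; apply/orP; right.
rewrite negb_exists; apply/forallP => l; rewrite !inE negb_or negb_and negb_and !negbK.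
case: (eqVneq l k) => //= lk; case: (boolP (l \in S)) => //= lS.
by have := on_boxPn xin xN lS; case: yE => ->; rewrite ?updE ?(negPf lk).
Qed.

(** Restriction of a chain to the interior of the cube changes its boundary only
    on the boundary of the cube and outside of the cube; what is
    left on the boundary of the cube is a cycle of a sphere, and bounds there. *)
Lemma bounds_localize N j (g : chain d q j) (b : chain d q j.+1)
    (Q : {fset cell d j.+1}) :
  (j.+1 < d)%N -> is_cycle g -> (forall t, t \in finsupp g -> in_cube N t) ->
  (forall t, t \in inner_cells d N j -> boundary b t = g t) ->
  (forall s, s \in finsupp b -> s \in inner_cells d N j.+1 -> s \in Q) ->
  (boundary_cells d N j.+1 `<=` Q)%fset ->
  bounds Q g.
Proof.
move=> jd gZ gN bg bQ /fsubsetP SQ.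
pose bin : chain d q j.+1 := chain_on (inner_cells d N j.+1) b.
have binN s : s \in finsupp bin -> in_cube N s.
  by move=> h; have := finsupp_chain_on h; rewrite in_inner_cells => /andP[].
have bing t : t \in inner_cells d N j -> boundary bin t = g t.
  move=> tI; rewrite -bg // !boundary_bd; move: tI; rewrite in_inner_cells => /andP[tin tN].
  apply: eq_bigr => k kt.
  suff H y : y = corner t \/ y = upd (corner t) k (corner t k - 1) ->
      raw bin y (k |: dirs t) = raw b y (k |: dirs t).
    by rewrite !H; [|left|right].
  move=> yE; have := coface_inner tin tN kt yE.
  rewrite /raw; case: insubP => // s _ sE; rewrite -[y]/((y, k |: dirs t).1).
  rewrite -[X in in_box _ _ X]/((y, k |: dirs t).2) -[X in on_box _ _ X]/((y, k |: dirs t).2).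
  by rewrite -sE => sI; rewrite chain_onE in_inner_cells sI.
pose g' : chain d q j := chain_on (cells_in_cube d N j) (fun t => g t - boundary bin t).
have g'E t : g' t = g t - boundary bin t.
  rewrite chain_onE in_cells_in_cube; case: ifP => // /negP/negP tN.
  rewrite (boundary_out binN tN) fsfun_notin ?subrr //.
  by apply: contra tN => /gN.
have g'N t : t \in finsupp g' -> in_cube N t.
  by rewrite -in_cells_in_cube; exact: finsupp_chain_on.
pose db : chain d q j := chain_on (cells_in_cube d N j) (boundary bin).
have dbE t : boundary bin t = db t.
  rewrite chain_onE in_cells_in_cube; case: ifP => // /negP/negP tN.
  exact: (boundary_out binN tN).
have dbN t : t \in finsupp db -> in_cube N t.
  by rewrite -in_cells_in_cube; exact: finsupp_chain_on.
have g'Z : is_cycle g'.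
  apply/(is_cycleP g'N) => f fB.
  under eq_bigr => t _ do rewrite g'E dbE mulrBl.
  rewrite sumrB ((is_cycleP gN).1 gZ f fB) ((is_cycleP dbN).1 _ f fB) ?subrr //.
  exact: boundary_is_cycle binN dbN dbE.
have g'S t : t \in finsupp g' -> on_cube_boundary N t.
  move=> tg; apply: contraTT tg => tN; rewrite mem_finsupp negbK g'E.
  have [tin|tout] := boolP (in_cube N t); first by rewrite bing ?subrr // in_inner_cells tin.
  by rewrite -g'E fsfun_notin //; apply: contra tout => /g'N.
have [c cS dc] := bounds_sphere jd g'Z g'S.
pose b' : chain d q j.+1 :=
  chain_on (inner_cells d N j.+1 `|` boundary_cells d N j.+1)%fset (fun s => bin s + c s).
have b'E s : b' s = bin s + c s.
  rewrite chain_onE; case: ifP => // /negP/negP; rewrite in_fsetU negb_or => /andP[sI sS].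
  by rewrite chain_onE (negPf sI) fsfun_notin ?addr0 //; apply: contra sS; exact: cS.
exists b' => [s sb|t]; last by rewrite (boundaryD t b'E) dc g'E addrC subrK.
have : s \in (inner_cells d N j.+1 `|` boundary_cells d N j.+1)%fset.
  by move: sb; exact: finsupp_chain_on.
rewrite in_fsetU => /orP[sI|]; last exact: SQ.
apply: bQ => //; move: sb; rewrite !mem_finsupp; apply: contra => /eqP bs.
rewrite b'E chain_onE sI bs add0r fsfun_notin //.
by apply/negP => /cS; move: sI; rewrite in_boundary_cells in_inner_cells => /andP[_ /negPf ->].
Qed.

Lemma cocyclesP N j (Q : {fset cell d j.+1}) (f : cochain d q N j) :
  reflect (forall s, s \in Q -> coboundary f s = 0) (f \in cocycles q N Q).
Proof.
rewrite inE; apply: (iffP forallP) => [H s sQ|H s].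
  by have /eqP := H (FSetSub sQ).
by rewrite H ?eqxx // fsvalP.
Qed.

(** Duality: a subgroup of (Z_q)^n is the annihilator of its annihilator, and the
    annihilator of the boundaries in Q is the group of cocycles of Q.  The characters
    behind this take values in R[i]. *)
Lemma bounds_dual (R : realType) N j (Q : {fset cell d j.+1}) (g : chain d q j) :
  (1 < q)%N -> (Q `<=` cells_in_cube d N j.+1)%fset ->
  (forall t, t \in finsupp g -> in_cube N t) ->
  bounds Q g <->
  (forall f, f \in cocycles q N Q -> \sum_(t : cells_in_cube d N j) g (val t) * f t = 0).
Proof.
move=> q1 /fsubsetP QN gN.
pose M : {set {ffun cells_in_cube d N j -> 'Z_q}} := [set x : {ffun cells_in_cube d N j -> 'Z_q} |
  `[< exists2 b : chain d q j.+1, (forall s, s \in finsupp b -> s \in Q) &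
    forall t : cells_in_cube d N j, boundary b (val t) = x t >]]%SET.
have memM (x : {ffun cells_in_cube d N j -> 'Z_q}) : reflect (exists2 b : chain d q j.+1, (forall s, s \in finsupp b -> s \in Q) &
    forall t : cells_in_cube d N j, boundary b (val t) = x t) (x \in M).
  by rewrite finset.inE; exact: asboolP.
have MZ : zmod_closed M.
  split=> [|x y].
    apply/memM; exists (chain_on Q (fun=> 0)) => [s /finsupp_chain_on //|t].
    rewrite ffunE boundary_bd /bd big1 // => k _.
    suff r0 z S : raw (chain_on Q (fun=> 0 : 'Z_q)) z S = 0 by rewrite !r0 subrr mulr0.
    apply: (@raw_supported _ _ (fun _ _ => false)) => // s _.
    by rewrite chain_onE if_same.
  move=> /memM[b bQ bx] /memM[b' b'Q b'y]; apply/memM.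
  exists (chain_on Q (fun s => b s - b' s)) => [s /finsupp_chain_on //|t].
  rewrite !ffunE -bx -b'y; apply: boundaryB => s; rewrite chain_onE; case: ifP => // /negP sQ.
  by rewrite !fsfun_notin ?subrr //; apply/negP; [move=> /b'Q|move=> /bQ].
have annM : annihilator M = cocycles q N Q.
  apply/setP => f; rewrite finset.inE; apply/forall_inP/cocyclesP => [H s sQ|fQ x].
    pose b : chain d q j.+1 := chain_on Q (fun u => (u == s)%:R).
    have bQ u : u \in finsupp b -> u \in Q by exact: finsupp_chain_on.
    have /H : [ffun t => boundary b (val t)] \in M.
      apply/memM; exists b => // t.
      by rewrite ffunE.
    move/eqP; rewrite /dot; under eq_bigr => t _ do rewrite ffunE mulrC.
    rewrite -summation_by_parts (sum_finsupp _ bQ).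
    rewrite (bigD1 (FSetSub sQ)) //= big1 => [|u us]; rewrite chain_onE ?sQ ?eqxx ?mul1r ?addr0 //.
    rewrite fsvalP; case: eqP => [uE|]; last by rewrite mul0r.
    by case/eqP: us; exact: val_inj.
  move=> /memM[b bQ bx]; apply/eqP; rewrite /dot.
  under eq_bigr => t _ do rewrite -bx mulrC.
  by rewrite -summation_by_parts big_seq big1 // => s /bQ sQ; rewrite fQ ?mulr0.
have := annihilatorK R q1 MZ; rewrite annM => /setP.
move=> /(_ [ffun t => g (val t)]) E; split=> [[b bQ bg] f fQ|H].
  have : [ffun t => g (val t)] \in M.
    by apply/memM; exists b => // t; rewrite ffunE bg.
  rewrite -E finset.inE => /forall_inP /(_ f fQ) /eqP; rewrite dotC /dot.
  by under eq_bigr => t _ do rewrite ffunE.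
have : [ffun t => g (val t)] \in M.
  rewrite -E finset.inE; apply/forall_inP => f fQ; apply/eqP; rewrite dotC /dot.
  by under eq_bigr => t _ do rewrite ffunE; exact: H.
move=> /memM[b bQ bx]; exists b => // t.
have [tN|tN] := boolP (t \in cells_in_cube d N j).
  by have := bx (FSetSub tN); rewrite ffunE.
rewrite in_cells_in_cube in tN.
rewrite (boundary_out _ tN) => [|s /bQ /QN]; last by rewrite in_cells_in_cube.
by rewrite fsfun_notin //; apply: contra tN => /gN.
Qed.
End Bounding.

(** * The Wilson loop in a cube *)

Section FiniteVolume.
Context {d q j : nat}.
Implicit Types (N : nat) (bc : boundary_condition) (P Q : {fset cell d j.+1}).

Lemma coboundaryB N (f g : cochain d q N j) (s : cell d j.+1) :
  coboundary (f - g) s = coboundary f s - coboundary g s.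
Proof.
by rewrite /coboundary -sumrB; apply: eq_bigr => t _; rewrite !ffunE mulrzBl.
Qed.

Lemma cocycles_zmod N Q : zmod_closed (cocycles q N Q : {set cochain d q N j}).
Proof.
split=> [|f g /cocyclesP fQ /cocyclesP gQ]; apply/cocyclesP => s sQ.
  by rewrite /coboundary big1 // => t _; rewrite ffunE mul0rz.
by rewrite coboundaryB fQ // gQ // subrr.
Qed.

Lemma cocyclesU N P Q : cocycles q N (P `|` Q)%fset =
  (cocycles q N P :&: cocycles q N Q)%SET :> {set cochain d q N j}.
Proof.
apply/setP => f; rewrite finset.in_setI; apply/cocyclesP/andP => [H|[/cocyclesP HP /cocyclesP HQ] s].
  by split; apply/cocyclesP => s sP; apply: H; rewrite in_fsetU sP ?orbT.
by rewrite in_fsetU => /orP[/HP|/HQ].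
Qed.

(** The cells that the boundary condition adds to each percolation subcomplex. *)
Definition environment N bc : {fset cell d j.+1} :=
  match bc with Free => fset0 | Wired => boundary_cells d N j.+1 end.

Lemma PRCM_complexE N bc P : PRCM_complex N bc P = (P `|` environment N bc)%fset.
Proof. by case: bc => //=; rewrite fsetU0. Qed.

Lemma environment_sub N bc : (environment N bc `<=` cells_in_cube d N j.+1)%fset.
Proof. by case: bc; rewrite ?fsub0set // fset_sub. Qed.

Lemma inner_sub N : (inner_cells d N j.+1 `<=` cells_in_cube d N j.+1)%fset.
Proof. exact: fset_sub. Qed.
End FiniteVolume.

Section Coboundaries.
Context {d q : nat}.

Lemma coboundaries_zmod N j : zmod_closed (coboundaries d q N j).
Proof.
case: j => [|j] /=; split.
- by apply/imsetP; exists 0; first (by rewrite finset.in_setT); apply/ffunP => t; rewrite !ffunE.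
- move=> f g /imsetP[a _ ->] /imsetP[b _ ->]; apply/imsetP; exists (a - b); first by rewrite finset.in_setT.
  by apply/ffunP => t; rewrite !ffunE.
- apply/imsetP; exists 0; first (by rewrite finset.in_setT); apply/ffunP => t; rewrite !ffunE.
  by rewrite /coboundary big1 // => u _; rewrite ffunE mul0rz.
- move=> f g /imsetP[a _ ->] /imsetP[b _ ->]; apply/imsetP; exists (a - b); first by rewrite finset.in_setT.
  by apply/ffunP => t; rewrite !ffunE coboundaryB.
Qed.

(** Each cohomology class is a coset of the group of coboundaries. *)
Lemma card_cohomology N j (Q : {fset cell d j.+1}) :
  (Q `<=` cells_in_cube d N j.+1)%fset ->
  #|@cocycles d q N j _ Q| = (#|@cohomology d q N j.+1 Q| * #|coboundaries d q N j|)%N.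
Proof.
move=> /fsubsetP QN; have [B0 BB] := coboundaries_zmod N j.
have [Z0 ZB] := @cocycles_zmod d q j N Q.
have BN f : f \in coboundaries d q N j -> - f \in coboundaries d q N j.
  by move=> fB; rewrite -sub0r; exact: BB.
have BZ f : f \in coboundaries d q N j -> f \in cocycles q N Q.
  move=> fB; apply/cocyclesP => s /QN; rewrite in_cells_in_cube.
  exact: coboundary_coboundaries.
apply: (@card_uniform_partition _ _ _ _ _ (equivalence_partitionP _)); last first.
  move=> f g h _ _ _ /=; split=> [|fg]; first by rewrite subrr.
  apply/idP/idP => [fh|gh].
    have -> : g - h = (f - h) - (f - g) by rewrite opprB [RHS]addrC addrA subrK.
    exact: BB.
  have -> : f - h = (f - g) - (- (g - h)) by rewrite opprK addrA subrK.
  exact/BB/BN.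
move=> C /imsetP[f fZ ->].
pose sub (b : cochain d q N j) : cochain d q N j := f - b.
transitivity #|(sub @: coboundaries d q N j)%SET|; last first.
  by apply: card_imset => b c /addrI/oppr_inj.
congr #|pred_of_set _|; apply/setP => g; rewrite finset.inE; apply/andP/imsetP => [[gZ fg]|[b bB ->]].
  by exists (f - g); rewrite // /sub subKr.
by split; [apply: ZB => //; exact: BZ | rewrite /sub subKr].
Qed.
End Coboundaries.

Section Expansion.
Context {R : realType} {d q j : nat}.
Context (beta : R) (beta_gt0 : 0 < beta).
Implicit Types (N : nat) (bc : boundary_condition) (P Q : {fset cell d j.+1}).

Local Notation t := (expR beta - 1).

(** The random-cluster weight up to a constant: here p / (1 - p) = exp(beta) - 1,
    and cocycles are counted instead of cohomology classes. *)
Definition cluster_weight N bc P : R :=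
  t ^+ #|` P| * #|(cocycles q N (P `|` environment N bc)%fset : {set cochain d q N j})|%:R.

Lemma expR_sub1_gt0 : 0 < t.
Proof. by rewrite subr_gt0 expR_gt1. Qed.

Lemma cluster_weight_gt0 N bc P : 0 < cluster_weight N bc P.
Proof.
rewrite mulr_gt0 ?exprn_gt0 ?expR_sub1_gt0 // ltr0n card_gt0; apply/set0Pn; exists 0.
exact: (cocycles_zmod N _).1.
Qed.

Lemma PRCM_weightE N bc (P : PRCM_config d j.+1 N) :
  PRCM_weight q (1 - expR (- beta)) bc P * #|coboundaries d q N j|%:R =
  expR (- beta) ^+ #|` inner_cells d N j.+1| * cluster_weight N bc (val P).
Proof.
have := fsvalP P; rewrite fpowersetE => PI.
rewrite /PRCM_weight /cluster_weight -mulrA -natrM -card_cohomology; last first.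
  rewrite PRCM_complexE fsubUset environment_sub andbT.
  exact: fsubset_trans PI (inner_sub N).
rewrite PRCM_complexE !mulrA subKr; congr (_ * _).
have -> : 1 - expR (- beta) = t * expR (- beta).
  by rewrite mulrBl mul1r -expRD subrr expR0.
rewrite exprMn -mulrA -exprD subnKC ?fsubset_leq_card // mulrC //.
Qed.

Lemma PRCM_mean N bc (h : {fset cell d j.+1} -> R) :
  \sum_(P : PRCM_config d j.+1 N) PRCM q (1 - expR (- beta)) bc P * h (val P) =
  (\sum_(P <- fpowerset (inner_cells d N j.+1)) cluster_weight N bc P * h P) /
  \sum_(P <- fpowerset (inner_cells d N j.+1)) cluster_weight N bc P.
Proof.
have B0 : (#|coboundaries d q N j|%:R : R) != 0.
  rewrite pnatr_eq0 -lt0n card_gt0; apply/set0Pn; exists 0.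
  exact: (coboundaries_zmod N j).1.
pose c : R := expR (- beta) ^+ #|` inner_cells d N j.+1| / #|coboundaries d q N j|%:R.
have c0 : c != 0 by rewrite mulf_neq0 ?invr_eq0 // expf_neq0 // gt_eqF ?expR_gt0.
have wE (P : PRCM_config d j.+1 N) : PRCM_weight q (1 - expR (- beta)) bc P = c * cluster_weight N bc (val P).
  by apply: (mulIf B0); rewrite PRCM_weightE /c [RHS]mulrAC divfK.
rewrite !big_seq_fsetE /= mulr_suml; apply: eq_bigr => P _.
rewrite /PRCM /normalized (eq_bigr (fun P : PRCM_config d j.+1 N => c * cluster_weight N bc (val P))) //.
by rewrite wE -mulr_sumr invfM mulrACA divff // mul1r mulrAC.
Qed.

Lemma prod_fpowerset (K : choiceType) (S : {fset K}) (a : K -> R) :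
  \prod_(s <- S) (1 + a s) = \sum_(P <- fpowerset S) \prod_(s <- P) a s.
Proof.
elim/finSet_rect: S => S IH; have [->|[x xS]] := fset_0Vmem S.
  by rewrite fpowerset0 big_seq_fset1 !big_seq_fset0.
rewrite -(fsetD1K xS) fsum_fpowersetU1 ?inE ?eqxx //.
rewrite big_fsetU1 /= ?inE ?eqxx // IH ?fproperD1 // mulr_sumr.
rewrite big_seq [RHS]big_seq; apply: eq_bigr => P; rewrite fpowersetE => /fsubsetP PS.
rewrite mulrDl mul1r big_fsetU1 //=; apply/negP => /PS; by rewrite !inE eqxx.
Qed.

(** The weight is a product over the cells, with a factor 1 + (exp(beta) - 1) for the
    cells on which the coboundary vanishes and 1 for the others. *)
Lemma PLGT_weight_expand N (f : cochain d q N j) :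
  @PLGT_weight R d q j.+1 N beta f =
  \sum_(P <- fpowerset (inner_cells d N j.+1)) t ^+ #|` P| * (f \in cocycles q N P)%:R.
Proof.
rewrite /PLGT_weight mulr_sumr expR_sum.
rewrite (eq_bigr (fun s => 1 + t * (coboundary f s == 0)%:R)) => [|s _]; last first.
  by case: eqP => _; rewrite ?mulr1 ?mulr0 ?addr0 ?expR0 // addrC subrK.
rewrite prod_fpowerset; apply: eq_bigr => P _.
rewrite big_split /= big_const_seq count_predT iter_mulr_1; congr (_ * _).
case: (boolP (f \in _)) => [/cocyclesP fP|].
  by rewrite big_seq big1 // => s sP; rewrite fP ?eqxx.
case: (boolP [exists s : P, coboundary f (val s) != 0]) => [/existsP[s fs] _|].
  by rewrite (big_fsetD1 (val s)) ?fsvalP //= (negPf fs) mul0r.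
rewrite negb_exists => /forallP H /cocyclesP[] s sP.
by have := H (FSetSub sP); rewrite negbK => /eqP.
Qed.

Lemma PLGT_weight_gt0 N (f : cochain d q N j) : 0 < @PLGT_weight R d q j.+1 N beta f.
Proof. exact: expR_gt0. Qed.

Local Notation Z N Q := (@cocycles d q N j j.+1 Q).
Local Notation env := (@environment d j).
Local Notation w := (@PLGT_weight R d q j.+1 _ beta).

(** Both boundary conditions amount to restricting the weights to the cocycles of the
    added cells. *)
Lemma PLGT_mean N bc (h : cochain d q N j -> R[i]) :
  \sum_(f : cochain d q N j) (@PLGT R d q j.+1 N beta bc f)%:C%C * h f =
  (\sum_(f in Z N (env N bc)) (w f)%:C%C * h f) / (\sum_(f in Z N (env N bc)) w f)%:C%C.
Proof.
have w0 : \sum_(f : cochain d q N j) w f != 0.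
  rewrite gt_eqF // (bigD1 (0 : cochain d q N j)) //= ltr_pwDl ?PLGT_weight_gt0 // sumr_ge0 // => f _.
  exact/ltW/PLGT_weight_gt0.
rewrite mulr_suml; case: bc => /=; last first.
  rewrite [RHS]big_mkcond; apply: eq_bigr => f _; rewrite /conditioned /normalized.
  case: ifP => _; last by rewrite mul0r.
  rewrite -mulr_suml [RHS]mulrAC -fmorphV -rmorphM /=; congr (_%:C%C * _).
  by rewrite invfM invrK mulrACA mulVf // mulr1.
have ZT : Z N fset0 =i predT by move=> f; apply/cocyclesP.
rewrite [in RHS](eq_bigl _ _ ZT); apply: eq_bigr => f _.
by rewrite (eq_bigl _ _ ZT) [RHS]mulrAC -fmorphV -rmorphM.
Qed.

(** Given the set P of cells of the expansion, the cochain is uniformly distributed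
    among the cocycles of P and of the boundary condition.  The Wilson loop is a
    character of this group, and by duality it is trivial exactly when the loop
    bounds. *)
Lemma wilson_loop_finite N bc (g : chain d q j) :
  (1 < q)%N -> (forall t, t \in finsupp g -> in_cube N t) ->
  \sum_(f : cochain d q N j) (@PLGT R d q j.+1 N beta bc f)%:C%C *
     wilson_loop R g (@PLGT_extend d q j.+1 N f) =
  (\sum_(P : PRCM_config d j.+1 N) PRCM q (1 - expR (- beta)) bc P *
     `[< bounds (val P `|` env N bc)%fset g >]%:R)%:C%C.
Proof.
move=> q_gt1 gN.
have gN' t : t \in finsupp g -> t \in cells_in_cube d N j.
  by move=> /gN; rewrite in_cells_in_cube.
pose l (f : cochain d q N j) := \sum_(t : cells_in_cube d N j) g (val t) * f t.
have lE f : evaluate (@PLGT_extend d q j.+1 N f) g = l f.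
  rewrite /evaluate (sum_finsupp _ gN'); apply: eq_bigr => t _.
  by rewrite PLGT_extend_in.
have lD : {morph l : f h / f + h}.
  by move=> f h; rewrite /l -big_split; apply: eq_bigr => t _; rewrite ffunE mulrDr.
have sumE (P : {fset cell d j.+1}) : P \in fpowerset (inner_cells d N j.+1) ->
  \sum_(f in Z N (env N bc)) (f \in Z N P)%:R * exp_2pii_div R (l f) =
  #|Z N (P `|` env N bc)%fset|%:R * `[< bounds (P `|` env N bc)%fset g >]%:R :> R[i].
  rewrite fpowersetE => PI.
  have PN : (P `|` env N bc `<=` cells_in_cube d N j.+1)%fset.
    by rewrite fsubUset environment_sub andbT; exact: fsubset_trans PI (inner_sub N).
  rewrite (eq_bigr (fun f => if f \in Z N P then exp_2pii_div R (l f) else 0)); last first.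
    by move=> f _; case: ifP => _; rewrite ?mul1r ?mul0r.
  rewrite -big_mkcondr /= (eq_bigl (mem (Z N (P `|` env N bc)%fset))); last first.
    move=> f; rewrite /= andbC -finset.in_setI -cocyclesU //.
  rewrite (sum_character R q_gt1 (cocycles_zmod N _) lD).
  have := bounds_dual R q_gt1 PN gN.
  case: ifP => [/forall_inP H E|/negP nH E].
    by rewrite asboolT ?mulr1 //; apply/E => f fP; apply/eqP/H.
  rewrite asboolF ?mulr0 // => /E H; apply: nH; apply/forall_inP => f fP; apply/eqP; exact: H.
rewrite PLGT_mean (PRCM_mean N bc (fun P => `[< bounds (P `|` env N bc)%fset g >]%:R)).
rewrite fmorph_div; congr (_ / _%:C%C); last first.
  rewrite /cluster_weight.
  under eq_bigr => f _ do rewrite PLGT_weight_expand.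
  rewrite exchange_big /=; apply: eq_bigr => P _; rewrite -mulr_sumr; congr (_ * _).
  rewrite cocyclesU -sumr_const [RHS](eq_bigl (fun f => (f \in Z N (env N bc)) && (f \in Z N P))).
    by rewrite [RHS]big_mkcondr; apply: eq_bigr => f _; case: ifP.
  by move=> f; rewrite finset.in_setI andbC.
rewrite rmorph_sum /= (eq_bigr (fun f => \sum_(P <- fpowerset (inner_cells d N j.+1))
    (t ^+ #|` P|)%:C%C * ((f \in Z N P)%:R * exp_2pii_div R (l f)))); last first.
  move=> f _; rewrite PLGT_weight_expand rmorph_sum /= mulr_suml; apply: eq_bigr => P _.
  by rewrite rmorphM /= rmorph_nat mulrA /wilson_loop lE.
rewrite exchange_big /= big_seq [RHS]big_seq; apply: eq_bigr => P PI.
by rewrite -mulr_sumr sumE // /cluster_weight !rmorphM /= !rmorph_nat mulrA.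
Qed.
End Expansion.

(** * Comparison of cubes *)

Section FiniteAbelianGroups.
Context {q : nat} {I J : finType}.
Local Notation V := {ffun I -> 'Z_q}.
Local Notation V' := {ffun J -> 'Z_q}.

(** The map (a, b) |-> a - b from the product of A and B to C has fibers that embed
    in the intersection of A and B, by translation. *)
Lemma leq_card_zmod_sum (A B C : {set V}) :
  zmod_closed A -> zmod_closed B -> zmod_closed C -> A \subset C -> B \subset C ->
  (#|A| * #|B| <= #|(A :&: B)%SET| * #|C|)%N.
Proof.
move=> [A0 AB] [B0 BB] [C0 CB] /fintype.subsetP AC /fintype.subsetP BC.
rewrite -cardsX -sum1_card.
rewrite (partition_big (fun p : V * V => p.1 - p.2) (mem C)) /=; last first.
  by move=> [a b]; rewrite finset.in_setX => /andP[/AC aC /BC bC]; exact: CB.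
rewrite -[X in (_ <= X)%N]mulnC -sum_nat_const; apply: leq_sum => c _.
pose F := [set p in finset.setX A B | p.1 - p.2 == c]%SET.
rewrite sum1_card.
have -> : #|[pred p in finset.setX A B | p.1 - p.2 == c]| = #|F|.
  by apply: eq_card => p; rewrite !finset.inE.
have [->|[p0 p0F]] := finset.set_0Vmem F; first by rewrite cards0.
have FP p : p \in F -> [/\ p.1 \in A, p.2 \in B & p.1 - p.2 = c].
  by rewrite !finset.inE => /andP[/andP[pA pB] /eqP pc].
pose phi (p : V * V) : V := p.1 - p0.1.
have [aA0 bB0 ab0] := FP _ p0F.
rewrite -(card_in_imset (f := phi)); last first.
  move=> [a b] [a' b'] /FP[/= _ _ ab] /FP[/= _ _ ab'] /addIr aE.
  by rewrite /= in aE; move: ab; rewrite -ab' aE => /addrI/oppr_inj ->.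
apply/subset_leq_card/fintype.subsetP => _ /imsetP[p /FP[pA pB pc] ->].
rewrite finset.in_setI; apply/andP; split; first exact: AB.
suff -> : phi p = p.2 - p0.2 by exact: BB.
have E p' : p'.1 - p'.2 = c -> p'.1 = c + p'.2 by move=> <-; rewrite subrK.
by rewrite /phi (E p) // (E p0) // opprD addrACA subrr add0r.
Qed.

(** All fibers of a homomorphism are translates of its kernel. *)
Lemma card_fibration (phi : V -> V') (A : {set V}) (B : {set V'}) :
  {morph phi : x y / x - y} -> zmod_closed A ->
  (forall x, x \in A -> phi x \in B) ->
  (forall y, y \in B -> exists2 x, x \in A & phi x = y) ->
  #|A| = (#|B| * #|[set x in A | phi x == 0%R]%SET|)%N.
Proof.
move=> phiB [A0 AB] AphiB BA.
rewrite -sum1_card (partition_big phi (mem B)) //= -sum_nat_const.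
apply: eq_bigr => y /BA[x0 x0A <-]; rewrite sum1_card.
pose tr (x : V) : V := x - x0.
rewrite -(card_imset (mem [pred x in A | phi x == phi x0]) (f := tr)); last first.
  by move=> x1 x2 /addIr.
apply: eq_card => z; apply/imsetP/idP => [[x /andP[xA /eqP xE] ->]|].
  by rewrite !finset.inE phiB xE subrr eqxx andbT; exact: AB.
rewrite !finset.inE => /andP[zA /eqP z0].
have N0 : phi (- x0) = - phi x0 by rewrite -sub0r phiB -(subrr 0) phiB !subrr sub0r.
have zx0 : z + x0 = z - (- x0) by rewrite opprK.
exists (z + x0); last by rewrite /tr addrK.
apply/andP; split; last by rewrite /= zx0 phiB z0 N0 sub0r opprK.
rewrite /= zx0; apply: (AB) => //.
by rewrite -sub0r; apply: (AB).
Qed.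
End FiniteAbelianGroups.

Section PowersetSums.
Context {K : choiceType} {U : nmodType}.
Implicit Types (S P D : {fset K}) (F : {fset K} -> U).
Local Open Scope fset_scope.

Lemma sum_fpowerset_sub S S' F : S `<=` S' ->
  \sum_(P <- fpowerset S' | P `<=` S) F P = \sum_(P <- fpowerset S) F P.
Proof.
move=> SS'; rewrite -big_filter; apply: perm_big; apply: uniq_perm.
- exact/filter_uniq/fset_uniq.
- exact: fset_uniq.
move=> P; rewrite mem_filter !fpowersetE; apply/andP/idP => [[]//|PS].
by split=> //; exact: fsubset_trans SS'.
Qed.

Lemma sum_fpowerset_sup S D F : [disjoint S & D] ->
  \sum_(P <- fpowerset (S `|` D) | D `<=` P) F P = \sum_(P <- fpowerset S) F (P `|` D).
Proof.
move=> /fdisjointP SD; rewrite -big_filter -[RHS](big_map (fun P => P `|` D) xpredT F).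
apply: perm_big; apply: uniq_perm.
- exact/filter_uniq/fset_uniq.
- rewrite map_inj_in_uniq ?fset_uniq // => P Q; rewrite !fpowersetE.
  move=> /fsubsetP PS /fsubsetP QS /fsetP PQ; apply/fsetP => x.
  have := PQ x; rewrite !in_fsetU; case: (boolP (x \in D)) => [xD _|]; last by rewrite !orbF.
  by apply/idP/idP => [/PS|/QS] /SD; rewrite xD.
move=> P; rewrite mem_filter !fpowersetE; apply/andP/mapP => [[DP PS]|[Q QS ->]]; last first.
  by rewrite fsubsetUr fsetSU // -fpowersetE.
exists (P `\` D); last first.
  apply/fsetP => x; rewrite in_fsetU in_fsetD.
  by case: (boolP (x \in D)) => [/(fsubsetP DP) ->|_]; rewrite ?orbF.
rewrite fpowersetE; apply/fsubsetP => x; rewrite in_fsetD => /andP[xD xP].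
by have := fsubsetP PS x xP; rewrite in_fsetU (negPf xD) orbF.
Qed.
End PowersetSums.

Section Cubes.
Context {d : nat}.

Lemma in_cube_le (N N' : nat) j (s : cell d j) : (N <= N')%N -> in_cube N s -> in_cube N' s.
Proof.
move=> NN' /forallP sN; apply/forallP => k; have := sN k; lia.
Qed.

Lemma inner_cells_le (N N' : nat) j (s : cell d j) : (N <= N')%N ->
  s \in inner_cells d N j -> s \in inner_cells d N' j.
Proof.
move=> NN'; rewrite !in_inner_cells => /andP[sN sB].
rewrite (in_cube_le NN' sN) /= negb_and negb_exists; apply/orP; right.
apply/forallP => k; rewrite negb_and -implybE; apply/implyP => ks.
have := @on_boxPn d N (corner s) (dirs s) k sN sB ks.
have /forallP /(_ k) := sN; rewrite (negPf ks); lia.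
Qed.

Lemma inner_cells_sub (N N' : nat) j : (N <= N')%N ->
  (inner_cells d N j `<=` inner_cells d N' j)%fset.
Proof. by move=> NN'; apply/fsubsetP => s; exact: inner_cells_le. Qed.
End Cubes.

Section Volumes.
Context {R : realType} {d q j : nat}.
Context (beta : R) (beta_gt0 : 0 < beta).
Implicit Types (N : nat) (bc : boundary_condition) (P Q : {fset cell d j.+1}).
Local Notation t := (expR beta - 1).
Local Notation Z N Q := (@cocycles d q N j j.+1 Q).
Local Notation env := (@environment d j).
Local Notation W := (@cluster_weight R d q j beta).
Local Notation inner N := (inner_cells d N j.+1).

(** The cocycles of the union are the common cocycles of P and Q, and the sums of a
    cocycle of P and one of Q are cocycles of the intersection. *)
Lemma card_cocycles_supermodular N P Q :
  (#|Z N P| * #|Z N Q| <= #|Z N (P `|` Q)%fset| * #|Z N (P `&` Q)%fset|)%N.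
Proof.
rewrite cocyclesU; apply: leq_card_zmod_sum; do ?exact: cocycles_zmod.
- apply/fintype.subsetP => f /cocyclesP fP; apply/cocyclesP => s.
  by rewrite in_fsetI => /andP[/fP].
- apply/fintype.subsetP => f /cocyclesP fP; apply/cocyclesP => s.
  by rewrite in_fsetI => /andP[_ /fP].
Qed.

Lemma cluster_weight_supermodular N bc P Q :
  W N bc P * W N bc Q <= W N bc (P `|` Q)%fset * W N bc (P `&` Q)%fset.
Proof.
have aux (a b c e k l m n : nat) : (k + l = m + n)%N -> (a * b <= c * e)%N ->
    t ^+ m * a%:R * (t ^+ n * b%:R) <= t ^+ k * c%:R * (t ^+ l * e%:R).
  move=> kl abce; rewrite mulrACA [leRHS]mulrACA -!exprD kl.
  by rewrite ler_pM2l ?exprn_gt0 ?expR_sub1_gt0 // -!natrM ler_nat.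
rewrite /cluster_weight fsetUUl fsetUIl.
exact: (aux _ _ _ _ _ _ _ _ (cardfsUI P Q) (card_cocycles_supermodular N _ _)).
Qed.

(** The cells outside the smaller cube that have to be added to the percolation
    subcomplexes of that cube, to compare them with those of a larger cube. *)
Definition annulus N N' bc : {fset cell d j.+1} :=
  match bc with Free => fset0 | Wired => (inner N' `\` inner N)%fset end.

Definition restrict_cochain N N' (f : cochain d q N' j) : cochain d q N j :=
  [ffun u => @PLGT_extend d q j.+1 N' f (val u)].

Lemma coboundary_restrict N N' (f : cochain d q N' j) (s : cell d j.+1) :
  in_cube N s -> coboundary (restrict_cochain N f) s = coboundary f s.
Proof.
move=> sN; rewrite [RHS]coboundary_cbd.
by apply: coboundary_cochain => // u; rewrite ffunE raw_cell.
Qed.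

Lemma restrict_cochainB N N' (f g : cochain d q N' j) : restrict_cochain N (f - g) = restrict_cochain N f - restrict_cochain N g.
Proof.
apply/ffunP => u; rewrite !ffunE /PLGT_extend.
by case: insubP => [v _ _|_]; rewrite ?ffunE ?subr0.
Qed.

Definition retract_cochain N N' (f : cochain d q N j) : cochain d q N' j :=
  [ffun u => retract N (raw (@PLGT_extend d q j.+1 N f)) (corner (val u)) (dirs (val u))].

Lemma clamp_id N a : - N%:Z <= a <= N%:Z -> clamp N a = a.
Proof. rewrite /clamp; lia. Qed.

Lemma clamp_in N a : - N%:Z <= clamp N a <= N%:Z.
Proof. rewrite /clamp; lia. Qed.

Lemma retract_in_cube (f : {ffun 'I_d -> int} -> {set 'I_d} -> 'Z_q) N i (s : cell d i) :
  in_cube N s -> retract N f (corner s) (dirs s) = f (corner s) (dirs s).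
Proof.
move=> /forallP sN; rewrite /retract ifT.
  congr f; apply/ffunP => k; rewrite ffunE clamp_id //.
  by have := sN k; lia.
by apply/forall_inP => k ks; have := sN k; rewrite ks.
Qed.

Lemma restrict_retract N N' (f : cochain d q N j) : (N <= N')%N ->
  restrict_cochain N (retract_cochain N' f) = f.
Proof.
move=> NN'; apply/ffunP => u; rewrite ffunE.
have uN : in_cube N (val u) by rewrite -in_cells_in_cube fsvalP.
have uN' : val u \in cells_in_cube d N' j by rewrite in_cells_in_cube (in_cube_le NN').
rewrite -[val u]/(val (FSetSub uN')) PLGT_extend_in ffunE /=.
by rewrite retract_in_cube // raw_cell PLGT_extend_in.
Qed.

(** A cell outside the cube is either collapsed or mapped to the boundary of the
    cube by the retraction. *)
Lemma coboundary_retract N N' (f : cochain d q N j) (s : cell d j.+1) :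
  in_cube N' s -> (in_cube N s -> coboundary f s = 0) ->
  (forall u : cell d j.+1, on_cube_boundary N u -> s \notin inner N -> coboundary f u = 0) ->
  coboundary (retract_cochain N' f) s = 0.
Proof.
move=> sN' fs fB.
rewrite (coboundary_cochain
  (g := retract N (raw (@PLGT_extend d q j.+1 N f)))) // => [|u]; last by rewrite ffunE.
rewrite cbd_retract; have [sN|sN] := boolP (in_cube N s).
  by rewrite retract_in_cube // -coboundary_cbd fs.
rewrite /retract; case: ifP => // /forall_inP ok.
have sI : s \notin inner N by rewrite in_inner_cells (negPf sN).
set y : {ffun 'I_d -> int} := [ffun k => _].
have Hc : #|(y, dirs s).2| == j.+1 by exact: valP s.
pose u : cell d j.+1 := exist _ (y, dirs s) Hc.
rewrite -[y]/(corner u) -[dirs s]/(dirs u) -coboundary_cbd; apply: fB => //.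
move: sN; rewrite negb_forall => /existsP[k sk].
have ks : k \notin dirs s by apply: contra sk => ks; rewrite ks ok.
apply/andP; split; last first.
  apply/existsP; exists k; rewrite ks /corner /= ffunE; move: sk; rewrite (negPf ks) /clamp; lia.
apply/forallP => l; rewrite /corner /dirs /= ffunE -/(dirs s).
case: (boolP (l \in dirs s)) => [/ok|_]; last by have := clamp_in N (corner s l); lia.
by move=> h; rewrite clamp_id //; lia.
Qed.

(** Up to the weight of the annulus, kappa counts the ways in which a cocycle of the
    smaller cube extends to the larger one.  By retraction there is always an
    extension, and two extensions differ by a cocycle that vanishes on the smaller
    cube; so their number does not depend on P. *)
Lemma cluster_weight_volume N N' bc : (N <= N')%N ->
  exists2 kappa : R, 0 < kappa &
    forall P, (P `<=` inner N)%fset ->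
      W N' bc (P `|` annulus N N' bc)%fset = kappa * W N bc P.
Proof.
move=> NN'; set D := annulus N N' bc.
have DP P : (P `<=` inner N)%fset -> [disjoint P & D]%fset.
  move=> /fsubsetP PI; apply/fdisjointP => s /PI sI; rewrite /D; case: (bc) => //=.
  by rewrite in_fsetD sI.
have DN s : s \in (D `|` env N' bc)%fset -> in_cube N' s && (s \notin inner N).
  rewrite in_fsetU /D; case: (bc) => //=.
  rewrite in_fsetD in_boundary_cells => /orP[/andP[-> ]|sB].
    by rewrite in_inner_cells => /andP[->].
  have /andP[-> _] := sB; apply/negP => /(inner_cells_le NN').
  by rewrite in_inner_cells sB andbF.
have envD s : s \in env N bc -> s \in (D `|` env N' bc)%fset.
  rewrite /D; case: (bc) => //=.
  rewrite in_fsetU in_fsetD !in_boundary_cells !in_inner_cells => sB.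
  have /andP[/(in_cube_le NN') sN' _] := sB.
  by rewrite sB sN' /= andbF /=; case: (on_cube_boundary N' s).
pose A P := Z N' (P `|` D `|` env N' bc)%fset.
pose K P := [set f in A P | restrict_cochain N f == 0]%SET.
have inK P f : (f \in K P) = (f \in A P) && (restrict_cochain N f == 0).
  exact: finset.in_set (fun f => (f \in A P) && (restrict_cochain N f == 0)) f.
have AP P f : reflect (forall s, s \in (P `|` (D `|` env N' bc))%fset -> coboundary f s = 0)
    (f \in A P).
  by rewrite fsetUA; exact: cocyclesP.
have AZ P : zmod_closed (A P) by exact: cocycles_zmod.
have AE P : Z N' (P `|` D `|` env N' bc)%fset = A P by [].
have KE0 P : [set f in A P | restrict_cochain N f == 0]%SET = K P by [].
clearbody K A.
have KE P : (P `<=` inner N)%fset -> K P = K fset0.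
  move=> /fsubsetP PI; apply/setP => f; rewrite (inK P f) (inK fset0 f).
  apply/andP/andP => -[/AP H /eqP f0]; (split; last by rewrite f0); apply/AP => s.
    by rewrite fset0U => sD; apply: H; rewrite in_fsetU sD orbT.
  rewrite in_fsetU => /orP[/PI|sD]; last by apply: H; rewrite fset0U.
  rewrite in_inner_cells => /andP[sN _]; rewrite -(coboundary_restrict _ sN) f0.
  by rewrite /coboundary big1 // => u _; rewrite ffunE mul0rz.
have AK P : (P `<=` inner N)%fset -> #|A P| = (#|Z N (P `|` env N bc)%fset| * #|K fset0|)%N.
  move=> PI; rewrite -(KE P PI) -KE0; apply: card_fibration.
  - exact: restrict_cochainB.
  - exact: AZ.
  - move=> f /AP fA; apply/cocyclesP => s sP.
    have sN : in_cube N s.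
      move: sP; rewrite in_fsetU => /orP[/(fsubsetP PI)|/(fsubsetP (environment_sub N bc))].
        by rewrite in_inner_cells => /andP[].
      by rewrite in_cells_in_cube.
    rewrite coboundary_restrict // fA // in_fsetU.
    by move: sP; rewrite in_fsetU => /orP[->|/envD ->]; rewrite ?orbT.
  - move=> f /cocyclesP fZ; exists (retract_cochain N' f); last exact: restrict_retract.
    apply/AP => s; rewrite in_fsetU => /orP[sP|sD].
      have sI := fsubsetP PI s sP; have sN : in_cube N s.
        by move: sI; rewrite in_inner_cells => /andP[].
      apply: coboundary_retract (in_cube_le NN' sN) _ _ => [_|u _ /negP//].
      by apply: fZ; rewrite in_fsetU sP.
    have /andP[sN' sI] := DN s sD.
    have fB (u : cell d j.+1) : on_cube_boundary N u -> coboundary f u = 0.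
      move=> uB; apply: fZ; rewrite in_fsetU; apply/orP; right.
      by move: sD; rewrite /D /annulus /environment; case: (bc);
        [rewrite fsetU0 in_fset0|rewrite in_boundary_cells].
    apply: coboundary_retract => // [sN|u uB _]; last exact: fB.
    by apply: fB; move: sI; rewrite in_inner_cells sN negbK.
exists (t ^+ #|` D| * #|K fset0|%:R).
  rewrite mulr_gt0 ?exprn_gt0 ?expR_sub1_gt0 // ltr0n card_gt0; apply/set0Pn; exists 0.
  rewrite inK (AZ _).1 /=; apply/eqP/ffunP => u.
  by rewrite !ffunE /PLGT_extend; case: insubP => // v _ _; rewrite ffunE.
move=> P PI; rewrite /cluster_weight AE AK // natrM.
have -> : #|` (P `|` D)%fset| = (#|` P| + #|` D|)%N.
  by rewrite -cardfsUI; have /eqP -> : (P `&` D)%fset == fset0 := DP P PI; rewrite cardfs0 addn0.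
by rewrite exprD mulrACA mulrC.
Qed.
End Volumes.

Definition increasing {K : choiceType} (A : {fset K} -> bool) :=
  forall P Q, (P `<=` Q)%fset -> A P -> A Q.

Section Association.
Context {R : realFieldType} {K : choiceType}.
Implicit Types (S P Q D : {fset K}) (A B : {fset K} -> bool) (w v : {fset K} -> R).
Local Open Scope fset_scope.

Definition weight_sum w S A : R := (\sum_(P <- fpowerset S) w P * (A P)%:R)%R.

Definition weight_mean w S A : R := (weight_sum w S A / weight_sum w S xpredT)%R.

Definition log_supermodular w :=
  (forall P, 0 < w P)%R /\ forall P Q, (w P * w Q <= w (P `|` Q) * w (P `&` Q))%R.

Lemma weight_sum_gt0 w S : log_supermodular w -> (0 < weight_sum w S xpredT)%R.
Proof.
move=> [w0 _]; rewrite /weight_sum (big_fsetD1 fset0) /=; last by rewrite fpowersetE fsub0set.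
by apply: ltr_pwDl => [|]; rewrite ?mulr1 // sumr_ge0 // => P _; rewrite mulr1 ltW.
Qed.

Lemma four_events w S A A' B B' : log_supermodular w ->
  (forall P Q, A P -> A' Q -> B (P `|` Q) && B' (P `&` Q)) ->
  (weight_sum w S A * weight_sum w S A' <= weight_sum w S B * weight_sum w S B')%R.
Proof.
move=> [w0 wPQ] AB.
have w_ge0 P : (0 <= w P)%R by exact: ltW.
apply: four_functions => [P|P|P|P|P Q]; do ?by rewrite mulr_ge0.
have := AB P Q; case: (A P) => [|_]; last by rewrite mulr0 mul0r !mulr_ge0.
case: (A' Q) => [/(_ isT isT)/andP[-> ->]|_]; last by rewrite !mulr0 !mulr_ge0.
by rewrite !mulr1.
Qed.

Lemma le_weight_mean w S A B : log_supermodular w ->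
  (forall P, P `<=` S -> A P -> B P) -> (weight_mean w S A <= weight_mean w S B)%R.
Proof.
move=> wL AB; rewrite ler_pM2r ?invr_gt0 ?weight_sum_gt0 //.
rewrite /weight_sum big_seq [leRHS]big_seq; apply: ler_sum => P.
rewrite fpowersetE => /AB h; rewrite ler_pM2l ?wL.1 // ler_nat.
by case: (A P) h => // ->.
Qed.

Lemma ler_div_cross (a b a' b' : R) :
  (0 < b -> 0 < b' -> a * b' <= a' * b -> a / b <= a' / b')%R.
Proof. by move=> b0 b'0 h; rewrite ler_pdivrMr // mulrAC ler_pdivlMr. Qed.

(** The weights v on S describe the weights w conditioned on the absence of all
    elements outside S.  This is a decreasing event, so it is negatively associated
    with the increasing event A. *)
Lemma weight_mean_absent w v S S' k A : S `<=` S' -> (0 < k)%R ->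
  log_supermodular v -> log_supermodular w ->
  (forall P, P `<=` S -> w P = k * v P)%R -> increasing A ->
  (weight_mean v S A <= weight_mean w S' A)%R.
Proof.
move=> SS' k0 vL wL kE Ainc.
have subE B : (weight_sum w S' (fun P => B P && (P `<=` S)) = k * weight_sum v S B)%R.
  rewrite /weight_sum mulr_sumr -(sum_fpowerset_sub _ SS') [RHS]big_mkcond.
  apply: eq_bigr => P _; case: ifP => PS; last by rewrite andbF mulr0.
  by rewrite andbT mulrA -kE.
apply: ler_div_cross; do ?exact: weight_sum_gt0.
rewrite -(ler_pM2l k0) mulrA [leRHS]mulrCA -!subE.
apply: four_events => // P Q /andP[AP PS] _.
by rewrite (Ainc P) ?fsubsetUl //= (fsubset_trans (fsubsetIl _ _)).
Qed.

(** Now v describes w conditioned on the presence of all elements outside S, an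
    increasing event, which is positively associated with A. *)
Lemma weight_mean_present w v S S' k A : S `<=` S' -> (0 < k)%R ->
  log_supermodular v -> log_supermodular w ->
  (forall P, P `<=` S -> w (P `|` (S' `\` S)) = k * v P)%R -> increasing A ->
  (forall P, A P = A (P `&` S)) ->
  (weight_mean w S' A <= weight_mean v S A)%R.
Proof.
move=> SS' k0 vL wL; set D := S' `\` S => kE Ainc Aloc.
have SE : S' = S `|` D.
  apply/fsetP => s; rewrite in_fsetU in_fsetD.
  by case: (boolP (s \in S)) => // /(fsubsetP SS').
have ND : [disjoint S & D] by apply/fdisjointP => s sS; rewrite in_fsetD sS.
have subE B : (forall P, P `<=` S -> B (P `|` D) = B P) ->
    (weight_sum w S' (fun P => B P && (D `<=` P)) = k * weight_sum v S B)%R.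
  move=> BD; transitivity (\sum_(P <- fpowerset S' | D `<=` P) w P * (B P)%:R)%R.
    rewrite /weight_sum [RHS]big_mkcond; apply: eq_bigr => P _.
    by case: ifP => PS; rewrite ?andbT // andbF mulr0.
  rewrite SE sum_fpowerset_sup // /weight_sum mulr_sumr big_seq [RHS]big_seq.
  by apply: eq_bigr => P; rewrite fpowersetE => PS; rewrite BD // mulrA kE.
apply: ler_div_cross; do ?exact: weight_sum_gt0.
rewrite -(ler_pM2l k0) mulrCA [leRHS]mulrA -!subE // => [|P PS].
  apply: four_events => // P Q AP /= DQ.
  by rewrite (Ainc P) ?fsubsetUl //= andbT (fsubset_trans DQ) ?fsubsetUr.
rewrite Aloc [RHS]Aloc; congr (A _); apply/fsetP => s; rewrite !in_fsetI in_fsetU.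
case: (boolP (s \in D)) => [|_]; rewrite ?orbF // in_fsetD => /andP[/negPf -> _].
by rewrite !andbF.
Qed.
End Association.

Section Comparison.
Context {R : realType} {d q j : nat}.
Context (beta : R) (beta_gt0 : 0 < beta).
Local Notation W := (@cluster_weight R d q j beta).
Local Notation inner N := (inner_cells d N j.+1).

Lemma cluster_weight_log_supermodular N bc : log_supermodular (W N bc).
Proof.
split=> [P|P Q]; first exact: cluster_weight_gt0.
exact: cluster_weight_supermodular.
Qed.

(** With free boundary conditions the measure in the smaller cube is the measure in
    the larger one conditioned on the absence of all other cells. *)
Lemma cluster_mean_free N N' A : (N <= N')%N -> increasing A ->
  weight_mean (W N Free) (inner N) A <= weight_mean (W N' Free) (inner N') A.
Proof.
move=> NN'; have [k k0 kE] := @cluster_weight_volume R d q j beta beta_gt0 N N' Free NN'.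
have kE' P : (P `<=` inner N)%fset -> W N' Free P = k * W N Free P.
  by move=> PN; rewrite -(kE P PN) fsetU0.
exact: (weight_mean_absent (inner_cells_sub j.+1 NN') k0
  (cluster_weight_log_supermodular N Free) (cluster_weight_log_supermodular N' Free) kE').
Qed.

(** With wired boundary conditions it is the measure in the larger cube conditioned
    on the presence of all other cells. *)
Lemma cluster_mean_wired N N' A : (N <= N')%N -> increasing A ->
  (forall P, A P = A (P `&` inner N)%fset) ->
  weight_mean (W N' Wired) (inner N') A <= weight_mean (W N Wired) (inner N) A.
Proof.
move=> NN'; have [k k0 kE] := @cluster_weight_volume R d q j beta beta_gt0 N N' Wired NN'.
exact: (weight_mean_present (inner_cells_sub j.+1 NN') k0
  (cluster_weight_log_supermodular N Wired) (cluster_weight_log_supermodular N' Wired) kE).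
Qed.
End Comparison.

(** * The topological events as limits of local events *)

Section Events.
Context {d q j : nat} (g : chain d q j).
Implicit Types (N : nat) (bc : boundary_condition) (P : cell d j.+1 -> bool).
Local Notation inner N := (inner_cells d N j.+1).
Local Notation env := (@environment d j).

Lemma in_restricted N P s : (s \in [fset s in inner N | P s]%fset) = (s \in inner N) && P s.
Proof. by rewrite in_fset /= inE. Qed.

Lemma bounds_sub (Q Q' : {fset cell d j.+1}) : (Q `<=` Q')%fset -> bounds Q g -> bounds Q' g.
Proof. by move=> /fsubsetP QQ' [b bQ bg]; exists b => // s /bQ /QQ'. Qed.

Definition local_event N bc : set (cell d j.+1 -> bool) :=
  [set P | bounds ([fset s in inner N | P s] `|` env N bc)%fset g].

(** The same event for a finite set of cells.  Only the interior cells of Q count, so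
    that the event is meaningful for configurations in larger cubes. *)
Definition local_indicator N bc (Q : {fset cell d j.+1}) : bool :=
  `[< bounds ((Q `&` inner N) `|` env N bc)%fset g >].

Lemma local_eventP N bc (Q : {fset cell d j.+1}) :
  local_event N bc (fun s => s \in Q) <-> local_indicator N bc Q.
Proof.
rewrite /local_event /local_indicator /=.
have -> : [fset s in inner N | s \in Q]%fset = (Q `&` inner N)%fset.
  by apply/fsetP => s; rewrite !inE andbC.
by split=> /asboolP.
Qed.

Lemma local_indicator_inc N bc : increasing (local_indicator N bc).
Proof.
move=> P Q PQ /asboolP gP; apply/asboolP; apply: bounds_sub gP.
by rewrite fsetSU // fsetSI.
Qed.

Lemma local_indicator_loc N bc Q :
  local_indicator N bc Q = local_indicator N bc (Q `&` inner N)%fset.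
Proof. by rewrite /local_indicator -fsetIA fsetIid. Qed.

Lemma local_indicator_inner N bc Q : (Q `<=` inner N)%fset ->
  local_indicator N bc Q = `[< bounds (Q `|` env N bc)%fset g >].
Proof. by move=> QN; rewrite /local_indicator (fsetIidPl QN). Qed.

Lemma local_event_cylinder N bc P P' :
  (forall s, s \in inner N -> P s = P' s) -> local_event N bc P = local_event N bc P'.
Proof.
move=> PP'; rewrite /local_event /=; congr (bounds (_ `|` _)%fset g).
apply/fsetP => s; rewrite !inE /=; case: (boolP (in_cube N s && ~~ on_cube_boundary N s)) => [sN|].
  by rewrite PP' // in_inner_cells.
by rewrite in_cells_in_cube => /negPf ->.
Qed.

Lemma exists_inner_cells i (F : {fset cell d i}) :
  exists n0, forall N, (n0 <= N)%N -> (F `<=` inner_cells d N i)%fset.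
Proof.
suff [n0 n0P] : exists n0, forall s, s \in F -> forall k, (`|corner s k| + 1 < n0)%N.
  exists n0 => N nN; apply/fsubsetP => s /n0P sk; rewrite in_inner_cells.
  apply/andP; split; first by apply/forallP => k; have := sk k; case: (k \in _); lia.
  rewrite negb_and negb_exists; apply/orP; right; apply/forallP => k.
  by rewrite negb_and; apply/orP; right; have := sk k; lia.
exists (\max_(s <- F) \max_k (`|corner s k| + 2))%N => s sF k.
have h1 : (`|corner s k| + 2 <= \max_k (`|corner s k| + 2))%N by exact: leq_bigmax.
apply: (leq_trans _ (leq_trans h1 _)); first by lia.
by rewrite (big_fsetD1 s) //= leq_maxl.
Qed.

Lemma local_event_free_mono N N' : (N <= N')%N -> local_event N Free `<=` local_event N' Free.
Proof.
move=> NN' P; rewrite /local_event /= !fsetU0; apply: bounds_sub.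
apply/fsubsetP => s; rewrite !in_fset /= !inE /= => /andP[sN ->].
rewrite andbT; have := fsubsetP (inner_cells_sub j.+1 NN') s.
by rewrite !inE /=; apply.
Qed.

Lemma V_fin_local : V_fin (i := j.+1) g = \bigcup_N local_event N Free.
Proof.
apply/seteqP; split=> P.
  move=> [b bP bg]; have [n0 n0P] := exists_inner_cells (finsupp b).
  exists n0 => //; exists b => // s sb; rewrite in_fsetU; apply/orP; left.
  have := fsubsetP (n0P n0 (leqnn _)) s sb.
  by rewrite !inE /= bP // andbT.
move=> [N _ [b bN bg]]; exists b => // s /bN.
by rewrite /= fsetU0 !inE /= => /andP[].
Qed.

(** A chain with boundary g in the interior of the cube can be completed on the
    boundary of the cube. *)
Lemma local_event_of_chain N P (b : chain d q j.+1) :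
  (j.+1 < d)%N -> is_cycle g -> (forall t, t \in finsupp g -> in_cube N t) ->
  (forall t, t \in inner_cells d N j -> boundary b t = g t) ->
  (forall s, s \in finsupp b -> s \in inner N -> P s) ->
  local_event N Wired P.
Proof.
move=> jd gZ gN bg bP; apply: (bounds_localize jd gZ gN bg) => [s sb sN|].
  by rewrite in_fsetU; apply/orP; left; have := sN; rewrite !inE /= => ->; rewrite bP.
exact: fsubsetUr.
Qed.

Lemma local_event_wired_mono N N' : (j.+1 < d)%N -> is_cycle g ->
  (forall t, t \in finsupp g -> in_cube N t) -> (N <= N')%N ->
  local_event N' Wired `<=` local_event N Wired.
Proof.
move=> jd gZ gN NN' P [b bP bg]; apply: (local_event_of_chain jd gZ gN (b := b)) => // s /bP.
rewrite in_fsetU => /orP[|]; first by rewrite !inE /= => /andP[].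
rewrite /environment in_boundary_cells => sB /(inner_cells_le NN').
by rewrite in_inner_cells sB andbF.
Qed.

(** If g bounds in P, or is homologous in P to a cycle on the boundary of a larger
    cube, then the part in a given cube of the chain that shows this can be completed
    on the boundary of that cube.  Conversely, if g bounds in P together with the
    boundary of a cube, then the part of the chain on that boundary has as boundary
    a cycle that is homologous to g in P. *)
Lemma V_inf_local n0 : (j.+1 < d)%N -> is_cycle g ->
  (forall t, t \in finsupp g -> in_cube n0 t) ->
  V_inf (i := j.+1) g = \bigcap_n local_event (n + n0) Wired.
Proof.
move=> jd gZ g0.
have gN n t : t \in finsupp g -> in_cube (n + n0) t.
  by move=> /g0; apply: in_cube_le; exact: leq_addl.
apply/seteqP; split=> P.
  move=> [[b bP bg] n _|H n _].
    by apply: (local_event_of_chain jd gZ (gN n) (b := b)) => // s /bP.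
  have [N [nN [g' [g'Z g'S [b bP bg]]]]] := H (n + n0)%N.
  apply: (local_event_of_chain jd gZ (gN n) (b := b)) => [t tI|s /bP //].
  suff g't : t \notin finsupp g' by rewrite bg (fsfun_notin g't) subr0.
  apply/negP => /g'S tB.
  by have := inner_cells_le nN tI; rewrite in_inner_cells tB andbF.
move=> H; right => m; exists (m + n0)%N; split; first exact: leq_addr.
set N := (m + n0)%N; have [b bP bg] := H m I.
pose b1 : chain d q j.+1 := chain_on [fset s in inner N | P s]%fset b.
pose b2 : chain d q j.+1 := chain_on (boundary_cells d N j.+1) b.
have bE s : b1 s = b s - b2 s.
  rewrite (chain_onE [fset s in inner N | P s]%fset) (chain_onE (boundary_cells d N j.+1)).
  have [sb|sb] := boolP (s \in finsupp b); last by rewrite (fsfun_notin sb) !if_same subrr.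
  have := bP s sb; rewrite in_fsetU in_restricted in_inner_cells in_boundary_cells.
  case: (on_cube_boundary N s) => /=; first by rewrite andbF subrr.
  by rewrite orbF => ->; rewrite subr0.
have b2S : supported (@on_box d N) (raw b2).
  apply: raw_supported => s sB; rewrite chain_onE in_boundary_cells.
  by rewrite /on_cube_boundary -/(on_cube_boundary N s) ifN.
pose g' : chain d q j := chain_on (boundary_cells d N j) (boundary b2).
have g'E t : boundary b2 t = g' t.
  rewrite chain_onE in_boundary_cells; case: ifP => // /negP/negP tB.
  by rewrite boundary_bd (bd_on_box b2S).
have g'S t : t \in finsupp g' -> on_cube_boundary N t.
  by rewrite -in_boundary_cells; exact: finsupp_chain_on.
exists g'; split=> //.
  apply: (@boundary_is_cycle d q N j b2) => // [s|t /g'S /andP[]//].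
  move=> sb; have : s \in boundary_cells d N j.+1 by move: sb; exact: finsupp_chain_on.
  by rewrite in_boundary_cells => /andP[].
exists b1 => [s sb|t]; last by rewrite (boundaryB _ bE) bg g'E.
have : s \in [fset s in inner N | P s]%fset by move: sb; exact: finsupp_chain_on.
by rewrite !inE /= => /andP[].
Qed.
End Events.

(** * Weak limits and cylinder events *)

Section Cylinders.
Context {I : choiceType} {S : pointedType}.
Local Notation C := (config I S).

Lemma nbhs_cylinder (r : seq I) (x : C) :
  nbhs x [set y : C | forall i, i \in r -> y i = x i].
Proof.
elim: r => [|i r IH].
  by apply: (@filterS _ (nbhs x) _ setT) => [y _ i //|]; exact: filterT.
have h : nbhs x (@proj I (fun _ => discrete_topology S) i @^-1` [set x i]).
  by apply: proj_continuous; exact: (@discrete_set1 (discrete_topology S) (x i)).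
apply: (@filterS _ (nbhs x) _ _ _ _ (filterI h IH)) => y [yi yr] k.
by rewrite inE => /predU1P[->|/yr].
Qed.

Lemma cylinder_continuous (T : topologicalType) (r : seq I) (h : C -> T) :
  (forall x y : C, (forall i, i \in r -> x i = y i) -> h x = h y) -> continuous h.
Proof.
move=> hr x U nU; have hU : U (h x) by exact: nbhs_singleton.
apply: (@filterS _ (nbhs x) _ _ _ _ (nbhs_cylinder r x)) => y /hr yx.
by rewrite /= yx.
Qed.

Lemma cylinder_open (r : seq I) (E : set C) :
  (forall x y : C, (forall i, i \in r -> x i = y i) -> E x = E y) -> open E.
Proof.
move=> Er; rewrite openE => x Ex.
by apply: (@filterS _ (nbhs x) _ _ _ _ (nbhs_cylinder r x)) => y /Er ->.
Qed.

Lemma cylinder_measurable (r : seq I) (E : set C) :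
  (forall x y : C, (forall i, i \in r -> x i = y i) -> E x = E y) ->
  measurable (E : set (borel_config I S)).
Proof. by move=> Er; apply: sub_sigma_algebra; exact: cylinder_open Er. Qed.

End Cylinders.

Section WeakLimit.
Context {R : realType} {I : choiceType} {S : pointedType} {T : nat -> finType}.
Context (m : forall N, T N -> R) (ext : forall N, T N -> (I -> S)).
Context (mu : probability (borel_config I S) R) (hmu : weak_limit m ext mu).

(** The indicator of an event that depends on finitely many coordinates is
    continuous. *)
Lemma weak_limit_event (r : seq I) (E : set (config I S)) :
  (forall x y : config I S, (forall i, i \in r -> x i = y i) -> E x = E y) ->
  (fun N => \sum_(x : T N) m x * \1_E (ext x)) @ \oo --> fine (mu E).
Proof.
move=> Er.
have -> : fine (mu E) = \int[mu]_x (\1_E x : R).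
  rewrite /Rintegral integral_indic ?setIT //; exact: cylinder_measurable Er.
apply: (hmu (h := \1_E : config I S -> R)).
  apply: (cylinder_continuous (r := r)) => x y /Er xy; rewrite !indicE.
  by have -> : (x \in E) = (y \in E) by apply/idP/idP; rewrite !in_setE xy.
exists 1; split; first exact: num_real.
move=> M M1 x _ /=; rewrite indicE; case: (x \in E); rewrite ?normr1 ?normr0; lra.
Qed.
End WeakLimit.

(** * The infinite volume limit *)

Lemma Re_sum (R : realType) (T : finType) (a : T -> R) (z : T -> R[i]) :
  complex.Re (\sum_x (a x)%:C%C * z x) = \sum_x a x * complex.Re (z x).
Proof.
rewrite (big_morph (@complex.Re R) (id1 := 0) (op1 := +%R)) //; last by case=> ? ? [].
by apply: eq_bigr => x _; case: (z x) => u v /=; rewrite mul0r subr0.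
Qed.

Lemma Im_sum (R : realType) (T : finType) (a : T -> R) (z : T -> R[i]) :
  complex.Im (\sum_x (a x)%:C%C * z x) = \sum_x a x * complex.Im (z x).
Proof.
rewrite (big_morph (@complex.Im R) (id1 := 0) (op1 := +%R)) //; last by case=> ? ? [].
by apply: eq_bigr => x _; case: (z x) => u v /=; rewrite mul0r addr0.
Qed.

Section WilsonLoop.
Context {R : realType} {d q j : nat} (g : chain d q j).

Lemma wilson_loop_cylinder (f h : cell d j -> 'Z_q) :
  (forall s, s \in finsupp g -> f s = h s) -> wilson_loop R g f = wilson_loop R g h.
Proof.
move=> fh; rewrite /wilson_loop /evaluate; congr (exp_2pii_div R _).
by rewrite big_seq [RHS]big_seq; apply: eq_bigr => s /fh ->.
Qed.

Context (beta : R) (bc : boundary_condition).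
Context (nu : probability (borel_config (cell d j) 'Z_q) R).
Context (hnu : @is_infinite_PLGT R d q j.+1 beta bc nu).

Lemma PLGT_limit (p : R[i] -> R) : (forall x : R, `|p (cos x +i* sin x)%C| <= 1) ->
  (fun N => \sum_f @PLGT R d q j.+1 N beta bc f * p (wilson_loop R g (PLGT_extend f)))
    @ \oo --> \int[nu]_x p (wilson_loop R g x).
Proof.
move=> p1; apply: (hnu (h := fun x => p (wilson_loop R g x))).
  apply: (cylinder_continuous (r := finsupp g)) => x y xy.
  by congr p; exact: wilson_loop_cylinder.
exists 1; split; first exact: num_real.
by move=> M M1 x _ /=; apply: le_trans (ltW M1); exact: p1.
Qed.
End WilsonLoop.

Section InfiniteVolume.
Context {R : realType} {d q j : nat} (q_gt1 : (1 < q)%N) (jd : (j.+1 < d)%N).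
Context (beta : R) (beta_gt0 : 0 < beta) (bc : boundary_condition).
Context (g : chain d q j) (gZ : is_cycle g).
Context (n0 : nat) (gn0 : forall t, t \in finsupp g -> in_cube n0 t).
Context (nu : probability (borel_config (cell d j) 'Z_q) R)
  (hnu : @is_infinite_PLGT R d q j.+1 beta bc nu).
Context (mu : probability (borel_config (cell d j.+1) bool) R)
  (hmu : @is_infinite_PRCM R d q j.+1 (1 - expR (- beta)) bc mu).
Local Notation mean N := (weight_mean (@cluster_weight R d q j beta N bc) (inner_cells d N j.+1)).
Local Notation E n := (local_event g (n + n0) bc).
Local Notation I n := (local_indicator g (n + n0) bc).

Local Notation L := (\int[nu]_x complex.Re (wilson_loop R g x)).

Lemma in_cube_n0 n t : t \in finsupp g -> in_cube (n + n0) t.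
Proof. by move=> /gn0; apply: in_cube_le; exact: leq_addl. Qed.

Lemma PRCM_weight_mean N (A : {fset cell d j.+1} -> bool) :
  \sum_(P : PRCM_config d j.+1 N) PRCM q (1 - expR (- beta)) bc P * (A (val P))%:R = mean N A.
Proof.
rewrite (PRCM_mean beta N bc (fun P => (A P)%:R)) /weight_mean /weight_sum; congr (_ / _).
by apply: eq_bigr => P _; rewrite mulr1.
Qed.

Lemma wilson_loop_mean n :
  \sum_f (@PLGT R d q j.+1 (n + n0) beta bc f)%:C%C * wilson_loop R g (PLGT_extend f) =
  (mean (n + n0)%N (I n))%:C%C.
Proof.
rewrite wilson_loop_finite //; last exact: in_cube_n0.
rewrite -PRCM_weight_mean; congr (_%:C)%C; apply: eq_bigr => P _.
by rewrite local_indicator_inner // -fpowersetE fsvalP.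
Qed.

(** A Wilson loop depends on finitely many cells, so its expectation passes to the weak
    limit. *)
Lemma mean_cvg_expectation :
  (fun n => mean (n + n0)%N (I n)) @ \oo --> L.
Proof.
have := @PLGT_limit R d q j g beta bc nu hnu (@complex.Re R) (@cos_max R).
rewrite -(cvg_shiftn n0); apply: cvg_trans; apply: near_eq_cvg; near=> n.
have := congr1 (@complex.Re R) (wilson_loop_mean n); rewrite Re_sum => E.
  exact: E.
Unshelve. all: by end_near.
Qed.

(** The finite volume expectations are probabilities. *)
Lemma expectation_real : \int[nu]_x complex.Im (wilson_loop R g x) = 0.
Proof.
have sin1 (x : R) : `|sin x| <= 1 by rewrite ler_norml sin_geN1 sin_le1.
have := @PLGT_limit R d q j g beta bc nu hnu (@complex.Im R) sin1.
rewrite -(cvg_shiftn n0) => h.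
have h0 : (fun _ : nat => 0 : R) @ \oo --> \int[nu]_x complex.Im (wilson_loop R g x).
  apply: cvg_trans h; apply: near_eq_cvg; near=> n.
  have := congr1 (@complex.Im R) (wilson_loop_mean n); rewrite Im_sum => E.
  exact: E.
exact: (cvg_unique (@norm_hausdorff _ R) h0 (cvg_cst 0)).
Unshelve. all: by end_near.
Qed.

Lemma event_cylinder n (x y : config (cell d j.+1) bool) :
  (forall s, s \in enum_fset (inner_cells d (n + n0) j.+1) -> x s = y s) -> E n x = E n y.
Proof. exact: local_event_cylinder. Qed.

Lemma event_measurable n : measurable (E n : set (borel_config (cell d j.+1) bool)).
Proof. by apply: (cylinder_measurable (r := inner_cells d (n + n0) j.+1)); exact: event_cylinder. Qed.

Lemma mean_cvg_event n : (fun N => mean (N + n0)%N (I n)) @ \oo --> fine (mu (E n)).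
Proof.
have := weak_limit_event hmu (@event_cylinder n).
rewrite -(cvg_shiftn n0); apply: cvg_trans; apply: near_eq_cvg; near=> N.
have EI (P : PRCM_config d j.+1 (N + n0)) :
    ((PRCM_extend P : config (cell d j.+1) bool) \in E n) = I n (val P).
  apply/idP/idP => [|h]; first by rewrite in_setE => /local_eventP.
  by rewrite in_setE; apply/local_eventP.
by rewrite /= -PRCM_weight_mean; apply: eq_bigr => P _; rewrite indicE EI.
Unshelve. all: by end_near.
Qed.

(** For free boundary conditions the measures of the cubes increase, and so do the
    events.  Thus the probability of the event of the n-th cube in the measure of the
    N-th cube, for n <= N, is at least the n-th and at most the N-th Wilson loop
    expectation; let N tend to infinity.  For wired boundary conditions everything
    decreases instead. *)
Lemma event_between n :
  match bc with
  | Free => mean (n + n0)%N (I n) <= fine (mu (E n)) <= L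
  | Wired => L <= fine (mu (E n)) <= mean (n + n0)%N (I n)
  end.
Proof.
have hE := @mean_cvg_event n; have hL := @mean_cvg_expectation.
have wL N := cluster_weight_log_supermodular (q := q) (j := j) (d := d) beta_gt0 N bc.
have le_N N : (n <= N)%N -> (n + n0 <= N + n0)%N by rewrite leq_add2r.
move: hE hL wL; case: bc => hE hL wL; apply/andP; split.
- apply: (cvgr_to_ge hE); near=> N; apply: cluster_mean_free => //.
    by apply: le_N; near: N; exact: nbhs_infty_ge.
  exact: local_indicator_inc.
- apply: (ler_cvg_to hE hL); near=> N; apply: le_weight_mean => // P PN.
  move=> /local_eventP/(local_event_free_mono (le_N N _)) h; apply/local_eventP; apply: h.
  by near: N; exact: nbhs_infty_ge.
- apply: (ler_cvg_to hL hE); near=> N; apply: le_weight_mean => // P PN.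
  move=> /local_eventP h; apply/local_eventP.
  apply: (local_event_wired_mono jd gZ (@in_cube_n0 n) (le_N N _)) h.
  by near: N; exact: nbhs_infty_ge.
- apply: (cvgr_to_le hE); near=> N; apply: cluster_mean_wired => //.
  + by apply: le_N; near: N; exact: nbhs_infty_ge.
  + exact: local_indicator_inc.
  + exact: local_indicator_loc.
Unshelve. all: by end_near.
Qed.

Lemma event_cvg_expectation :
  (fun n => fine (mu (E n))) @ \oo --> L.
Proof.
have hL := @mean_cvg_expectation; have h := event_between.
move: h hL; case: bc => /= h hL.
  by apply: (squeeze_cvgr _ hL (cvg_cst _)); apply: nearW => n; exact: h.
by apply: (squeeze_cvgr _ (cvg_cst _) hL); apply: nearW => n; exact: h.
Qed.

Lemma event_cvg_V : (fun n => fine (mu (E n))) @ \oo --> fine (mu (V_event (i := j.+1) bc g)).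
Proof.
have := event_measurable; case: bc => mE; apply: fine_cvg => /=.
  have VE : V_fin (i := j.+1) g = \bigcup_n local_event g (n + n0) Free.
    rewrite V_fin_local; apply/seteqP; split=> P [N _ EP]; last by exists (N + n0)%N.
    by exists N => //; apply: local_event_free_mono EP; exact: leq_addr.
  have mV : measurable (V_fin (i := j.+1) g : set (borel_config (cell d j.+1) bool)).
    by rewrite VE; apply: bigcup_measurable => n _; exact: mE.
  rewrite fineK ?fin_num_measure // VE.
  apply: nondecreasing_cvg_mu => //; first by rewrite -VE.
  move=> n m nm; apply/subsetPset; apply: local_event_free_mono.
  by rewrite leq_add2r.
have VE := V_inf_local jd gZ gn0.
have mV : measurable (V_inf (i := j.+1) g : set (borel_config (cell d j.+1) bool)).
  by rewrite VE; apply: bigcap_measurableType => n _; exact: mE.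
rewrite fineK ?fin_num_measure // VE.
apply: nonincreasing_cvg_mu => //; last 2 first.
- by rewrite -VE.
- move=> n m nm; apply/subsetPset.
  apply: (local_event_wired_mono jd gZ (@in_cube_n0 n)); by rewrite leq_add2r.
by rewrite -ge0_fin_numE // fin_num_measure.
Qed.
End InfiniteVolume.

Theorem theorem7 (R : realType) (d i q : nat) (hi : (0 < i < d - 1)%N)
    (hq : (2 <= q)%N) (beta : R) (hbeta : 0 < beta)
    (gamma : chain d q i.-1) (hgamma : is_cycle gamma)
    (bc : boundary_condition)
    (nu : probability (borel_config (cell d i.-1) 'Z_q) R)
    (hnu : is_infinite_PLGT beta bc nu)
    (mu : probability (borel_config (cell d i) bool) R)
    (hmu : is_infinite_PRCM q (1 - expR (- beta)) bc mu) :
  complex_expectation nu (wilson_loop R gamma) =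
    real_complex R (fine (mu (V_event bc gamma))).
Proof.
case: i hi gamma hgamma nu hnu mu hmu => [|j] // hi gamma hgamma nu hnu mu hmu.
have jd : (j.+1 < d)%N by lia.
have [n0 n0P] := exists_inner_cells (finsupp gamma).
have gn0 t : t \in finsupp gamma -> in_cube n0 t.
  by move=> /(fsubsetP (n0P _ (leqnn _))); rewrite in_inner_cells => /andP[].
rewrite /complex_expectation (expectation_real hq gn0 hnu).
congr (_ +i* _)%C.
have toE := event_cvg_expectation hq jd hbeta hgamma gn0 hnu hmu.
have toV : (fun n => fine (mu (local_event gamma (n + n0) bc))) @ \oo -->
    fine (mu (V_event bc gamma)) by exact: event_cvg_V.
exact: (cvg_unique (@norm_hausdorff _ R) toE toV).
Qed.
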